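(* Let $\Gamma$ be a group. Suppose given two comparable actions of $\Gamma$ on roughly geodesically complete Gromov hyperbolic spaces $(X,d)$ and $(Y,d')$, both of which are geometrically dense. Assume that there exist a subgroup $\Gamma'$ of $\Gamma$ and an element $h\in\Gamma$ such that the limit set of $\Gamma'$ equals the limit set of $\Gamma$ for both actions (i.e. $\Lambda_X\Gamma'=\Lambda_X\Gamma$ and $\Lambda_Y\Gamma'=\Lambda_Y\Gamma$), and $\ell_d=\ell_{d'}$ on the left coset $h\Gamma'$ or on the right coset $\Gamma'h$. Then $\ell_d=\ell_{d'}$ on $\Gamma$, and there exists a $\Gamma$-equivariant rough isometry $\phi:X\to Y$, i.e. there exists a constant $C>0$ such that for all $p,q\in X$, $$|d'(\phi(p),\phi(q))-d(p,q)|<C.$$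
   Context: For a metric space $(X,d)$ and $o\in X$, the Gromov product is $\langle p,q\rangle_o=\frac12(d(p,o)+d(q,o)-d(p,q))$. $(X,d)$ is $\delta$-Gromov hyperbolic if $\langle p,q\rangle_o\ge\min\{\langle p,r\rangle_o,\langle r,q\rangle_o\}-\delta$ for all $o,p,q,r\in X$, and Gromov hyperbolic if this holds for some $\delta>0$. The Gromov boundary $\partial X$ is the set of equivalence classes of sequences $(x_n)$ in $X$ with $\langle x_i,x_j\rangle_o\to\infty$, where $(x_n)\sim(y_n)$ if $\langle x_i,y_j\rangle_o\to\infty$; it carries its usual topology. A map $\phi:(X,d)\to(Y,d')$ is a $C$-roughly isometric embedding if $|d'(\phi(p),\phi(q))-d(p,q)|\le C$ for all $p,q$, and a $C$-rough isometry if moreover its image is cobounded (there is $L$ such that every point of $Y$ is within distance $L$ of $\phi(X)$). A $K$-rough geodesic is a $K$-roughly isometric embedding of an interval; a space is $K$-roughly geodesic if any two points are joined by a $K$-rough geodesic. $(X,d)$ is roughly geodesically complete if there exist $K,\delta>0$ such that: (i) $(X,d)$ is $K$-roughly geodesic and $\delta$-Gromov hyperbolic; (ii) it is $K$-visual: for every $p\in X$ and $x\in\partial X$ there is a $K$-rough geodesic path starting from $p$ and converging to $x$; (iii) it is $K$-roughly complete: for any $p,q\in X$ there is an infinite $K$-rough geodesic path passing through $p$, $q$ and converging to some $x\in\partial X$. All actions are by isometries. The limit set $\Lambda_X\Gamma$ (and similarly $\Lambda_X\Gamma'$) is $\overline{\Gamma\cdot o}\cap\partial X$ (independent of $o$).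 A hyperbolic element is one with positive translation length; it has exactly two fixed points in $\partial X$. An action is non-elementary if $\Gamma$ contains two hyperbolic elements with disjoint pairs of fixed points in $\partial X$, and quasi-parabolic if $\Gamma$ contains hyperbolic elements and has exactly one global fixed point in $\partial X$, with limit set having more than two points. The action on $X$ is geometrically dense if it is non-elementary or quasi-parabolic and $\Lambda_X\Gamma=\partial X$. Two actions on $X$ and $Y$ are comparable if there is a $\Gamma$-equivariant homeomorphism $\Lambda_X\Gamma\to\Lambda_Y\Gamma$. The translation length is $\ell_d(\gamma)=\lim_{n\to\infty}\frac{d(\gamma^n o,o)}{n}$.
   Formalization: Exact Γ-equivariance of φ can fail (Z/2*Z/3 acting on its tree X and freely on itself as Y), so ''Γ-equivariant'' is replaced by d'(φ(gp), gφ(p)) ≤ C for all g and p, with exact equivariance along the orbit of every p whose stabilizer fixes φ(p). *)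

(* Defs.v *)
From HB Require Import structures.
From mathcomp Require Import all_boot all_order all_algebra.
From mathcomp Require Import all_classical all_reals all_analysis.

Set Implicit Arguments.
Unset Strict Implicit.
Unset Printing Implicit Defensive.

Import Order.TTheory GRing.Theory Num.Theory.
Import numFieldTopology.Exports numFieldNormedType.Exports.

Local Open Scope classical_set_scope.
Local Open Scope ring_scope.

Section Hyperbolicity.
Context {R : realType} {X : metricType R}.
Implicit Types (o p q : X) (x y : nat -> X).

Definition gromov_product o p q : R :=
  (mdist p o + mdist q o - mdist p q) / 2.

(* The Gromov product with base point [o], indexed by a pair of indices, tends
   to infinity when both indices do. The choice of [o] only changes the Gromov
   products by a bounded amount. *)
Definition gromov_related x y : Prop := forall o,
  gromov_product o (x ij.1) (y ij.2) @[ij --> (\oo, \oo)] --> +oo.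

Definition gromov_sequence x : Prop := gromov_related x x.

Definition gromov_class x : set (nat -> X) :=
  [set y | gromov_sequence y /\ gromov_related x y].

End Hyperbolicity.

Definition hyperbolic {R : realType} (delta : R) (X : metricType R) : Prop :=
  forall o p q r : X,
    Order.min (gromov_product o p r) (gromov_product o r q) - delta
      <= gromov_product o p q.

(* Encoding a boundary point as the set of sequences of its class avoids having
   to know that [gromov_related] is transitive, which fails without
   hyperbolicity. *)
Definition boundary {R : realType} (X : metricType R) : Type :=
  set_type [set xi | exists2 x : nat -> X,
    gromov_sequence x & xi = gromov_class x].

HB.instance Definition _ {R : realType} (X : metricType R) :=
  Choice.on (boundary X).

Definition bordification {R : realType} (X : metricType R) : Type :=
  (X + boundary X)%type.

HB.instance Definition _ {R : realType} (X : metricType R) :=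
  Choice.on (bordification X).

Section Bordification.
Context {R : realType} (X : metricType R).
Implicit Types (o p : X) (xi : boundary X) (b : bordification X).

Definition interior_pt p : bordification X := inl p.
Definition boundary_pt xi : bordification X := inr xi.

Definition representatives b : set (nat -> X) :=
  match b with inl p => [set cst p] | inr xi => \val xi end.

(* The [b] such that the supremum, over the sequences x representing [xi] and y
   representing [b], of liminf_{i,j} <x_i, y_j>_o exceeds [r] (up to an
   arbitrarily small change of [r]). *)
Definition boundary_nbhd o xi (r : R) : set (bordification X) :=
  [set b | exists x y, [/\ representatives (boundary_pt xi) x,
     representatives b y &
     \forall i \near \oo & j \near \oo, r < gromov_product o (x i) (y j)]].

(* [X] keeps its metric topology and is open; the sets [boundary_nbhd o xi r],
   [r : R], are a basis of (not necessarily open) neighborhoods of [xi] when [X]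
   is hyperbolic. The Gromov boundary carries the subspace topology. *)
Definition bordification_open (U : set (bordification X)) : Prop :=
  open (interior_pt @^-1` U) /\
  forall xi, U (boundary_pt xi) ->
    forall o, exists r, boundary_nbhd o xi r `<=` U.

Let bordification_openT : bordification_open setT.
Proof. by split=> [|xi _ o]; [exact: openT|exists 0]. Qed.

Let bordification_openI : setI_closed bordification_open.
Proof.
move=> U V [oU nU] [oV nV]; split; first exact: openI.
move=> xi [Uxi Vxi] o.
have [r rU] := nU _ Uxi o; have [s sV] := nV _ Vxi o.
exists (Num.max r s) => b [x [y [xx yb xy]]]; split.
- apply: rU; exists x, y; split=> //.
  by apply: filterS xy => ij; rewrite gt_max => /andP[].
- apply: sV; exists x, y; split=> //.
  by apply: filterS xy => ij; rewrite gt_max => /andP[].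
Qed.

Let bordification_open_bigU (I : Type) (f : I -> set (bordification X)) :
  (forall i, bordification_open (f i)) -> bordification_open (\bigcup_i f i).
Proof.
move=> fo; split.
  by rewrite preimage_bigcup; apply: bigcup_open => i _; have [] := fo i.
move=> xi [i _ fixi] o; have [_ /(_ _ fixi o)[r rf]] := fo i.
by exists r => b /rf fb; exists i.
Qed.

HB.instance Definition _ := isOpenTopological.Build (bordification X)
  bordification_openT bordification_openI bordification_open_bigU.

Definition gromov_boundary : set (bordification X) := range boundary_pt.

End Bordification.

Arguments gromov_boundary {R} X _.

Section RoughGeometry.
Context {R : realType}.

Definition rough_embedding (K : R) {X Y : metricType R} (phi : X -> Y) : Prop :=
  forall p q, `|mdist (phi p) (phi q) - mdist p q| <= K.

Definition cobounded {X Y : metricType R} (phi : X -> Y) : Prop :=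
  exists L : R, forall y, exists x, mdist y (phi x) <= L.

Definition rough_isometry (K : R) {X Y : metricType R} (phi : X -> Y) : Prop :=
  rough_embedding K phi /\ cobounded phi.

(* Only the values of [c] on the interval [I] matter. *)
Definition rough_geodesic (K : R) {X : metricType R} (I : interval R)
    (c : R -> X) : Prop :=
  {in I &, forall s t, `|mdist (c s) (c t) - `|s - t| | <= K}.

Definition roughly_geodesic (K : R) (X : metricType R) : Prop :=
  forall p q : X, exists a b (c : R -> X),
    [/\ a <= b, rough_geodesic K `[a, b] c, c a = p & c b = q].

Definition rough_ray (K : R) {X : metricType R} (c : R -> X)
    (xi : boundary X) : Prop :=
  rough_geodesic K `[0, +oo[ c /\
  interior_pt (c t) @[t --> +oo] --> boundary_pt xi.

Definition visual (K : R) (X : metricType R) : Prop :=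
  forall (p : X) (xi : boundary X), exists2 c, rough_ray K c xi & c 0 = p.

Definition roughly_complete (K : R) (X : metricType R) : Prop :=
  forall p q : X, exists c xi s t,
    [/\ rough_ray K c xi, 0 <= s, 0 <= t, c s = p & c t = q].

Definition roughly_geodesically_complete (X : metricType R) : Prop :=
  exists K delta : R, [/\ 0 < K, 0 < delta,
    roughly_geodesic K X /\ hyperbolic delta X,
    visual K X & roughly_complete K X].

End RoughGeometry.

Record isometric_action {R : realType} (G : groupType) (X : metricType R) := {
  act :> G -> X -> X;
  act1 : forall p, act 1%g p = p;
  actM : forall g h p, act (g * h)%g p = act g (act h p);
  act_isometry : forall g p q, mdist (act g p) (act g q) = mdist p q }.

Section BoundaryAction.
Context {R : realType} {G : groupType} {X : metricType R}.
Variable a : isometric_action G X.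

Lemma act_invK (g : G) : cancel (a g) (a g^-1%g).
Proof. by move=> p; rewrite -actM mulVg act1. Qed.

Lemma actK_inv (g : G) : cancel (a g^-1%g) (a g).
Proof. by move=> p; rewrite -actM mulgV act1. Qed.

Lemma gromov_related_act (g : G) (x y : nat -> X) :
  gromov_related x y -> gromov_related (a g \o x) (a g \o y).
Proof.
move=> xy o; apply: cvg_trans (xy (a g^-1%g o)).
have E p : mdist p (a g^-1%g o) = mdist (a g p) o.
  by rewrite -(act_isometry a g) actK_inv.
apply: near_eq_cvg; apply: nearW => ij /=.
by rewrite /gromov_product !E -(act_isometry a g (x _)).
Qed.

Definition act_class (g : G) (xi : set (nat -> X)) : set (nat -> X) :=
  [set a g \o x | x in xi].

Lemma act_classE (g : G) (x : nat -> X) :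
  act_class g (gromov_class x) = gromov_class (a g \o x).
Proof.
apply/seteqP; split=> [_ [y [yg xy] <-]|y [yg xy]].
  by split; exact: gromov_related_act.
have yE : a g \o (a g^-1%g \o y) = y by apply/funext => n /=; rewrite actK_inv.
have xE : a g^-1%g \o (a g \o x) = x by apply/funext => n /=; rewrite act_invK.
exists (a g^-1%g \o y) => //; split; first exact: gromov_related_act.
by rewrite -xE; exact: gromov_related_act.
Qed.

Lemma act_class_boundary (g : G) (xi : boundary X) :
  act_class g (\val xi) \in
    [set xi | exists2 x : nat -> X, gromov_sequence x & xi = gromov_class x].
Proof.
case: xi => /= xi /set_mem[x gx ->]; apply/mem_set.
by exists (a g \o x); [exact: gromov_related_act|exact: act_classE].
Qed.

Definition act_boundary (g : G) (xi : boundary X) : boundary X :=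
  exist _ (act_class g (\val xi)) (act_class_boundary g xi).

Definition act_bordification (g : G) (b : bordification X) : bordification X :=
  match b with
  | inl p => interior_pt (a g p)
  | inr xi => boundary_pt (act_boundary g xi)
  end.

(* Limit set of the elements of [H] (usually a subgroup). The choice of [o]
   does not matter, since it changes orbits by a bounded amount. *)
Definition limit_set (H : set G) : set (bordification X) :=
  [set b | forall o, closure [set interior_pt (a g o) | g in H] b]
    `&` gromov_boundary X.

(* As this limit does not depend on the base point, statements about translation
   lengths below quantify the base point. *)
Definition translation_length (o : X) (g : G) : R :=
  limn (fun n => mdist (a (g ^+ n)%g o) o / n%:R).

Definition hyperbolic_element (g : G) : Prop :=
  exists o, 0 < translation_length o g.

Definition boundary_fixed_points (g : G) : set (bordification X) :=
  gromov_boundary X `&` [set b | act_bordification g b = b].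

Definition non_elementary : Prop :=
  exists g h, [/\ hyperbolic_element g, hyperbolic_element h &
    boundary_fixed_points g `&` boundary_fixed_points h = set0].

Definition quasi_parabolic : Prop :=
  [/\ exists g, hyperbolic_element g,
      exists b, \bigcap_g boundary_fixed_points g = [set b] &
      exists b1 b2 b3, [/\ limit_set setT b1, limit_set setT b2,
        limit_set setT b3 & [/\ b1 <> b2, b2 <> b3 & b1 <> b3]]].

Definition geometrically_dense : Prop :=
  (non_elementary \/ quasi_parabolic) /\ limit_set setT = gromov_boundary X.

End BoundaryAction.

Section TwoActions.
Context {R : realType} {G : groupType} {X Y : metricType R}.
Variables (a : isometric_action G X) (b : isometric_action G Y).

(* [limit_set a setT] is used here as a type, with the subspace topology.
   Equivariance is expressed in the ambient bordifications. *)
Definition comparable_actions : Prop :=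
  exists (f : limit_set a setT -> limit_set b setT)
         (f' : limit_set b setT -> limit_set a setT),
    [/\ cancel f f', cancel f' f, continuous f, continuous f' &
      forall g x y, \val y = act_bordification a g (\val x) ->
        \val (f y) = act_bordification b g (\val (f x))].

(* Equivariance in the coarse sense. Exact equivariance
   [phi (a g p) = b g (phi p)] for all g and p would force every stabilizer of a
   point of X to fix a point of Y, which a rough isometry cannot ensure. The
   second clause asks for exact equivariance wherever the stabilizer of [p] is
   not an obstruction to it: on all of X when the action on X is free. *)
Definition roughly_equivariant (C : R) (phi : X -> Y) : Prop :=
  (forall g p, mdist (phi (a g p)) (b g (phi p)) <= C) /\
  (forall p, (forall g, a g p = p -> b g (phi p) = phi p) ->
     forall g, phi (a g p) = b g (phi p)).

End TwoActions.

(* Main.v *)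
Require Import Defs.
From mathcomp Require Import all_boot all_order all_algebra.
From mathcomp Require Import all_classical all_reals all_analysis.
From mathcomp Require Import lra zify.

(** The theorem holds because the marked length spectrum on one coset of the
    subgroup [H] determines the cross ratios of boundary points up to a bounded
    error, and these determine the space up to rough isometry. Everything is read on
    the boundaries, which an equivariant homeomorphism [F] identifies; [(x|y)_o]
    below stands for the Gromov product, and all equalities hold up to bounded
    errors.

    The main step is that [F] preserves the cross ratio
    [(x|y) + (z|t) - (x|t) - (z|y)] of boundary points up to a uniform error. Let
    the orbit points of an isometry [e] and of its inverse tend to two directions.
    By the four-point condition ([translation_length_axial],
    [translation_length_mul]) the translation length of a product of such isometries
    is the sum of the displacements of the factors minus twice the Gromov products
    at the junctions of the cyclic word. In the combination
    [l(e x) + l(e y) - l(e x y) - l(e)] the displacements cancel and twice a cross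
    ratio remains ([cross_ratio_of_lengths]). Lengths are invariant under
    conjugation, so that the two length functions agree on the double coset [H h H],
    in which [e] is chosen, whereas [x] and [y] are chosen in [H].

    If [H] fixes no boundary point, all its orbits on the boundary are dense, since
    an element moving [o] close to [xi] moves to [xi] at least one of any two
    boundary points ([orbit_limit_pair]). Starting from one axial element of [H],
    this density yields elements of [H h H] and of [H] with arbitrary pairs of
    directions ([double_coset_ends]), in both spaces at once
    ([orbit_transfer]), hence all cross ratios ([cross_ratio_transfer_dense]).

    If [H] fixes a boundary point [i], all its axes end at [i], so that the factors
    of the words above may cancel completely and another argument is needed. Let
    [k] in [H] translate towards [z] and away from [i]. The lengths of [h k^n] show
    that [k^n] moves the base points of both spaces by the same amount. Continuity
    of [F] at [z] compares the projections of [w] and [F w] to the axis when [w] is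
    close to [z], and the powers of [k] carry this comparison to all [w]
    ([axis_coord_transfer]). So cross ratios containing [z] and [i] are preserved;
    the orbit of [z] is dense and the error is the same for all its points, so [z]
    can be replaced by any point, and a cocycle identity then removes [i]
    ([cross_ratio_transfer_fixed]).

    It remains to extend [F] to the interior. Call [p] and [y] compatible when
    [(x|t)_p] and [(F x|F t)_y] agree for all boundary points [x] and [t]. Each [p]
    has a compatible [y], found on a line between the images of two boundary points
    seen from [p] in opposite directions ([exists_compatible]). Distances in each
    space are suprema of differences of Busemann functions, which are combinations
    of Gromov products ([compatible_dist]); therefore a choice of compatible points
    is a rough isometry, it is unique up to bounded distance and so coarsely
    equivariant, and the symmetric construction shows that it is cobounded.
    Iterating a coarsely equivariant rough isometry along the powers of an element
    shows that its two translation lengths are equal. *)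

Set Implicit Arguments.
Unset Strict Implicit.
Unset Printing Implicit Defensive.

Import Order.TTheory GRing.Theory Num.Theory.
Import numFieldTopology.Exports numFieldNormedType.Exports.

Local Open Scope classical_set_scope.
Local Open Scope ring_scope.

(** * Gromov products *)

Notation gp := gromov_product.

(** Linear arithmetic treats the two orders of the arguments of a distance as
    unrelated atoms; one of them is eliminated beforehand. *)
Ltac metric_norm := repeat match goal with
  | |- context [mdist ?p ?q] => match goal with
    | |- context [mdist q p] =>
      tryif constr_eq p q then fail else rewrite !(metric_sym q p)
    end
  end.

Ltac metric_lra :=
  repeat match goal with H : context [mdist _ _] |- _ => revert H end;
  metric_norm; intros; lra.

Section GromovProduct.
Context {R : realType} {X : metricType R}.
Implicit Types o p q r : X.

Lemma gpC o p q : gp o p q = gp o q p.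
Proof. by rewrite /gp; metric_lra. Qed.

Lemma gp_ge0 o p q : 0 <= gp o p q.
Proof. by have := metric_triangle p o q; rewrite /gp; metric_lra. Qed.

Lemma gp_le o p q : gp o p q <= mdist o p.
Proof. by have := metric_triangle o p q; rewrite /gp; metric_lra. Qed.

Lemma gp_switch o p q : gp o p q = mdist o p - gp p o q.
Proof. by rewrite /gp; metric_lra. Qed.

Lemma mdist_gp o p q : mdist p q = mdist o p + mdist o q - 2 * gp o p q.
Proof. by rewrite /gp; metric_lra. Qed.

Lemma gp_lip o p p' q : gp o p q - mdist p p' <= gp o p' q.
Proof.
have := metric_triangle p p' o; have := metric_triangle p' p q.
by rewrite /gp; metric_lra.
Qed.

Lemma gp_lip_base o o' p q : gp o p q - mdist o o' <= gp o' p q.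
Proof.
have := metric_triangle p o' o; have := metric_triangle q o' o.
by rewrite /gp; metric_lra.
Qed.

Variable delta : R.
Hypothesis hX : hyperbolic delta X.

Lemma gp_hyp o p r q :
  gp o p r - delta <= gp o p q \/ gp o r q - delta <= gp o p q.
Proof.
by have := hX o p q r; rewrite lerBlDr ge_min -!lerBlDr => /orP.
Qed.

Lemma gp_trans r o p q (s : R) :
  s + delta <= gp o p r -> s + delta <= gp o r q -> s <= gp o p q.
Proof. by case: (gp_hyp o p r q); lra. Qed.

End GromovProduct.

(** * Subadditive and stationary sequences *)

Section Subadditive.
Context {R : realType}.

Lemma subadditive_mul (u : nat -> R) :
  (forall m n, u (m + n)%N <= u m + u n) ->
  forall k m, u (k * m)%N <= k%:R * u m + u 0%N.
Proof.
move=> us; elim=> [|k IH] m; first by rewrite !mul0n mul0r add0r.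
rewrite mulSn -natr1 mulrDl mul1r.
by have := us m (k * m)%N; have := IH m; lra.
Qed.

(** Fekete's lemma: writing [n = q m + r], the term of index [n] is at most [q] times
    that of index [m], up to a bounded remainder, for [m] nearly realizing the
    infimum. *)
Lemma subadditive_cvg (u : nat -> R) :
  (forall m n, u (m + n)%N <= u m + u n) -> (forall n, 0 <= u n) ->
  cvgn (fun n => u n / n%:R).
Proof.
move=> us u0; pose S := [set u n.+1 / n.+1%:R | n in setT].
have S0 : has_inf S.
  split; first by exists (u 1%N / 1%:R); exists 0%N.
  by exists 0 => _ [n _ <-]; rewrite divr_ge0.
apply/cvg_ex; exists (inf S); apply/cvgrPdist_le => e e0.
have e20 : 0 < e / 2 by rewrite divr_gt0.
have [_ [m _ <-] mS] := inf_adherent e20 S0.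
set l := inf S in mS *.
have e30 : 0 < e / 3 by rewrite divr_gt0.
pose B := \sum_(i < m.+1) u i + u 0%N.
have B0 : 0 <= B by rewrite addr_ge0// sumr_ge0.
near=> n.
have n0 : (0 < n)%N by near: n; exact: nbhs_infty_gt.
have nR0 : 0 < n%:R :> R by rewrite ltr0n.
have lle : l <= u n / n%:R.
  apply: ge_inf; first by case: S0.
  by exists n.-1 => //; rewrite prednK.
have Bn : B / n%:R <= e / 3.
  rewrite ler_pdivrMr// -ler_pdivrMl//.
  near: n; exact: nbhs_infty_ger.
rewrite ler0_norm ?subr_le0// opprB.
have m0 : 0 < m.+1%:R :> R by rewrite ltr0n.
have mle : u m.+1 <= m.+1%:R * (l + e / 2).
  by rewrite mulrC -ler_pdivrMr// ltW.
have : u n <= (n %/ m.+1)%:R * u m.+1 + B.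
  rewrite {1}(divn_eq n m.+1).
  have := us (n %/ m.+1 * m.+1)%N (n %% m.+1)%N.
  have := subadditive_mul us (n %/ m.+1) m.+1.
  have : u (n %% m.+1)%N <= \sum_(i < m.+1) u i.
    have lt := ltn_pmod n (ltn0Sn m).
    rewrite (bigD1 (Ordinal lt))//= lerDl sumr_ge0//.
  by rewrite /B; lra.
have : (n %/ m.+1)%:R * u m.+1 <= n%:R * (l + e / 2).
  apply: (le_trans (ler_wpM2l _ mle)); first exact: ler0n.
  rewrite mulrA ler_wpM2r//.
    have : 0 <= u m.+1 by [].
    by move=> /le_trans /(_ mle); rewrite pmulr_rge0.
  by rewrite -natrM ler_nat leq_divM.
move=> h1 h2.
have : u n / n%:R <= l + e / 2 + B / n%:R.
  rewrite ler_pdivrMr// mulrDl divfK ?gt_eqF// mulrC mulrDr.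
  by have := h1; rewrite mulrDr; lra.
by lra.
Unshelve. all: by end_near. Qed.

End Subadditive.

Lemma cvg_ratio_le {R : realType} (u v : nat -> R) (C l l' : R) :
  (forall n, u n <= v n + C) ->
  (fun n => u n / n%:R) @ \oo --> l -> (fun n => v n / n%:R) @ \oo --> l' ->
  l <= l'.
Proof.
move=> uv ul vl; apply/ler_addgt0Pr => e e0.
have e30 : 0 < e / 3 by rewrite divr_gt0.
have h1 : \forall n \near \oo, `|l - u n / n%:R| <= e / 3.
  by move/cvgrPdist_le : ul; exact.
have h2 : \forall n \near \oo, `|l' - v n / n%:R| <= e / 3.
  by move/cvgrPdist_le : vl; exact.
near \oo => n.
have k1 : `|l - u n / n%:R| <= e / 3 by near: n.
have k2 : `|l' - v n / n%:R| <= e / 3 by near: n.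
have n0 : 0 < n%:R :> R by rewrite ltr0n; near: n; exact: nbhs_infty_gt.
have h3 : C / n%:R <= e / 3.
  rewrite ler_pdivrMr// -ler_pdivrMl//; near: n; exact: nbhs_infty_ger.
have h4 : u n / n%:R <= v n / n%:R + C / n%:R.
  by rewrite -mulrDl ler_wpM2r ?invr_ge0// ltW.
move: k1 k2; rewrite !ler_norml => /andP[? ?] /andP[? ?]; lra.
Unshelve. all: by end_near. Qed.

Lemma cvg_linear_ratio {R : realType} (c : R) :
  (fun n => n%:R * c / n%:R) @ \oo --> c.
Proof.
apply: (@cvg_trans _ (nbhs c)); last exact: cvg_id.
apply: cvg_near_cst; near=> n.
have n0 : n%:R != 0 :> R by rewrite gt_eqF// ltr0n; near: n; exact: nbhs_infty_gt.
by rewrite mulrC mulKf.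
Unshelve. all: by end_near. Qed.

(** The orbit of a point under the powers of an isometry has this form: distances
    depend only on the gap between indices. If the second distance exceeds the first
    one by more than [4 delta], the four-point condition keeps this growth at all
    later steps. *)
Section StationarySequence.
Context {R : realType} {X : metricType R}.
Variables (delta : R) (x : nat -> X) (A : nat -> R).
Hypotheses (hX : hyperbolic delta X) (delta0 : 0 <= delta).
Hypothesis xA : forall i k, mdist (x i) (x (i + k)%N) = A k.
Hypothesis gap : 4 * delta < A 2%N - A 1%N.

Let A0 : A 0%N = 0. Proof. by rewrite -(xA 0 0) mdistxx. Qed.

(** The Gromov product of [x 0] and [x n.+2] at [x n.+1] stays within [delta] of
    that of the two neighbours of [x n.+1], because [x n] and [x 0] lie in the same
    direction. *)
Lemma stationary_incr n :
  `|A n.+2 - A n.+1 - (A 2%N - A 1%N)| <= 2 * delta.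
Proof.
elim: n => [|n]; first by rewrite subrr normr0 mulr_ge0.
have e i j k : (i + k = j)%N -> mdist (x i) (x j) = A k by move=> <-.
have e1 := e 0%N n.+1 n.+1 erefl; have e2 := e 0%N n.+2 n.+2 erefl.
have e3 := e 0%N n.+3 n.+3 erefl; have e4 := e n.+1 n.+2 1%N (addn1 _).
have e5 := e n.+1 n.+3 2%N (addn2 _); have e6 := e n.+2 n.+3 1%N (addn1 _).
have h1 := gp_hyp hX (x n.+2) (x 0%N) (x n.+1) (x n.+3).
have h2 := gp_hyp hX (x n.+2) (x n.+1) (x 0%N) (x n.+3).
rewrite !ler_norml => /andP[i1 i2]; have g0 := gap; have d0 := delta0.
by apply/andP; split; case: h1; case: h2; rewrite /gp; metric_lra.
Qed.


Let slope := A 2%N - A 1%N.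

Lemma stationary_upper n : A n <= n%:R * (slope + 2 * delta) + A 1%N.
Proof.
case: n => [|n]; first by rewrite A0 mul0r add0r -(xA 0 1) mdist_ge0.
have s0 : 0 <= slope + 2 * delta by have g0 := gap; have d0 := delta0; rewrite /slope; lra.
suff : A n.+1 <= n%:R * (slope + 2 * delta) + A 1%N by rewrite -natr1; lra.
elim: n => [|n IH]; first by rewrite mul0r add0r.
by have := stationary_incr n; rewrite ler_norml -natr1 => /andP[]; move: IH;
  rewrite /slope; lra.
Qed.

Lemma stationary_lower n : n%:R * (slope - 2 * delta) <= A n.
Proof.
case: n => [|n]; first by rewrite A0 mul0r.
suff : n%:R * (slope - 2 * delta) + A 1%N <= A n.+1.
  have := metric_triangle (x 0) (x 1) (x 2).
  by have d0 := delta0; rewrite (xA 0 1) (xA 1 1) (xA 0 2) /slope -natr1; lra.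
elim: n => [|n IH]; first by rewrite mul0r add0r.
by have := stationary_incr n; rewrite ler_norml -natr1 => /andP[]; move: IH;
  rewrite /slope; lra.
Qed.

(** Each step away from [x 0] gains a definite amount; this makes the orbit of an
    axial isometry a Gromov sequence. *)
Lemma stationary_gp i k :
  i%:R * (slope - 2 * delta) <= gp (x 0%N) (x i) (x (i + k)%N).
Proof.
have inc n : slope - 2 * delta <= A n.+1 - A n.
  case: n => [|n]; last first.
    by have := stationary_incr n; rewrite ler_norml => /andP[]; rewrite /slope; lra.
  have := metric_triangle (x 0) (x 1) (x 2); have d0 := delta0.
  by rewrite A0 (xA 0 1) (xA 1 1) (xA 0 2) /slope; lra.
have h n j : n%:R * (slope - 2 * delta) <= A (j + n)%N - A j.
  elim: n => [|n IH]; first by rewrite addn0 mul0r subrr.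
  by rewrite addnS -natr1; have := inc (j + n)%N; move: IH; lra.
have := h i 0%N; have := h i k; rewrite add0n A0 => h1 h2.
rewrite (addnC k) in h1.
by have := xA 0 i; have := xA 0 (i + k)%N; have := xA i k; rewrite !add0n /gp;
  metric_lra.
Qed.

(** The past and the future of an intermediate point lie in directions that
    diverge by a definite amount; this separates the two limits of the powers of an
    axial isometry. *)
Lemma stationary_opposite i j :
  gp (x i.+1) (x 0%N) (x (i.+1 + j.+1)%N) <= A 1%N - A 2%N / 2 + 2 * delta.
Proof.
have g0 := gap; have d0 := delta0.
have s1 : 2 * gp (x i.+1) (x 0%N) (x i.+2) <= 2 * A 1%N - A 2%N + 2 * delta.
  have := stationary_incr i; rewrite ler_norml => /andP[+ _].
  have := xA 0 i.+1; have := xA 0 i.+2; have := xA i.+1 1; rewrite !add0n addn1.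
  by rewrite /gp; metric_lra.
have s2 : 2 * gp (x i.+1) (x i.+2) (x (i.+1 + j.+1)%N) >=
    A 1%N + slope - 2 * delta.
  have s : slope - 2 * delta <= A j.+1 - A j.
    case: j => [|j]; last first.
      by have := stationary_incr j; rewrite ler_norml => /andP[]; rewrite /slope; lra.
    have := metric_triangle (x 0) (x 1) (x 2).
    by rewrite A0 (xA 0 1) (xA 1 1) (xA 0 2) /slope; lra.
  have := xA i.+1 1; have := xA i.+1 j.+1; have := xA i.+2 j.
  by rewrite addn1 (addSnnS i.+1) /gp; metric_lra.
have := gp_hyp hX (x i.+1) (x 0%N) (x (i.+1 + j.+1)%N) (x i.+2).
by rewrite (gpC _ (x (i.+1 + j.+1)%N)) => -[]; move: s1 s2; rewrite /slope; lra.
Qed.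

End StationarySequence.

(** * Translation lengths of products *)

Section Isometries.
Context {R : realType} {G : groupType} {X : metricType R}.
Variable a : isometric_action G X.
Implicit Types (g u v : G) (o p q : X).

Lemma act_gp g o p q : gp (a g o) (a g p) (a g q) = gp o p q.
Proof. by rewrite /gp !act_isometry. Qed.

Lemma gp_actV g o p q : gp o (a g p) (a g q) = gp (a g^-1%g o) p q.
Proof. by rewrite -(act_gp g^-1%g) !act_invK. Qed.

Lemma mdist_actV g p q : mdist p (a g q) = mdist (a g^-1%g p) q.
Proof. by rewrite -(act_isometry a g^-1%g) act_invK. Qed.

Lemma mdist_invg g o : mdist o (a g^-1%g o) = mdist o (a g o).
Proof. by rewrite metric_sym -mdist_actV. Qed.

Lemma gp_act_base g o p :
  gp o (a g o) (a g p) = mdist o (a g o) - gp o (a g^-1%g o) p.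
Proof. by rewrite gp_actV gp_switch metric_sym mdist_invg. Qed.

Lemma mdist_expg g o i k :
  mdist (a (g ^+ i)%g o) (a (g ^+ (i + k))%g o) = mdist (a (g ^+ k)%g o) o.
Proof. by rewrite expgnDr actM act_isometry metric_sym. Qed.

Lemma displacement_cvg g o : cvgn (fun n => mdist (a (g ^+ n)%g o) o / n%:R).
Proof.
apply: (@subadditive_cvg _ (fun n => mdist (a (g ^+ n)%g o) o)) => [m n|n].
  have D := mdist_expg g o m n.
  by have := metric_triangle o (a (g ^+ m)%g o) (a (g ^+ (m + n))%g o); metric_lra.
exact: mdist_ge0.
Qed.

Lemma translation_length_conj o g k :
  translation_length a o (k * g * k^-1)%g = translation_length a (a k^-1%g o) g.
Proof.
rewrite /translation_length; congr (limn _); apply/funext => n.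
suff -> : ((k * g * k^-1) ^+ n)%g = (k * g ^+ n * k^-1)%g.
  by rewrite !actM [mdist _ o]metric_sym (mdist_actV k) [mdist (a k^-1%g o) _]metric_sym.
elim: n => [|n IH]; first by rewrite !expg0 mulg1 mulgV.
by rewrite !expgS IH !mulgA mulgVK.
Qed.

End Isometries.

Lemma translation_length_eq {R : realType} {G : groupType} {X Y : metricType R}
    (a : isometric_action G X) (b : isometric_action G Y) (C : R) g o o' :
  (forall n, `|mdist (b (g ^+ n)%g o') o' - mdist (a (g ^+ n)%g o) o| <= C) ->
  translation_length a o g = translation_length b o' g.
Proof.
move=> h; have cv := @displacement_cvg _ _ _ a g o.
have cv' := @displacement_cvg _ _ _ b g o'.
apply/eqP; rewrite eq_le; apply/andP; split.
  by apply: (@cvg_ratio_le _ _ _ C _ _ _ cv cv') => n; have /ler_normlP[? ?] := h n; lra.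
by apply: (@cvg_ratio_le _ _ _ C _ _ _ cv' cv) => n; have /ler_normlP[? ?] := h n; lra.
Qed.

Section TranslationLength.
Context {R : realType} {G : groupType} {X : metricType R}.
Variables (a : isometric_action G X) (delta : R).
Hypotheses (hX : hyperbolic delta X) (delta0 : 0 <= delta).
Implicit Types (e g u v x y : G) (o p q : X).

(** A point can be replaced by one far along the same direction at the cost of
    [delta], as long as the Gromov product stays below the common part. *)
Lemma gp_replace (M : R) o p p' q : gp o p q <= M -> M + delta < gp o p p' ->
  `|gp o p' q - gp o p q| <= delta.
Proof.
move=> h1 h2; apply/ler_normlP; case: (gp_hyp hX o p p' q) => ?;
  case: (gp_hyp hX o p' p q); rewrite ?(gpC o p' p) => ?; split; lra.
Qed.

Lemma gp_replace2 (M : R) o p p' q q' : gp o p q <= M ->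
  M + 2 * delta < gp o p p' -> M + 2 * delta < gp o q q' ->
  `|gp o p' q' - gp o p q| <= 2 * delta.
Proof.
have d0 := delta0; move=> h1 h2 h3.
have h4 : `|gp o p' q - gp o p q| <= delta by apply: (@gp_replace M) => //; lra.
move: (h4); rewrite ler_norml => /andP[h5 h6].
have : `|gp o q' p' - gp o q p'| <= delta.
  by apply: (@gp_replace (M + delta)); [rewrite gpC|]; lra.
by rewrite (gpC o q' p') (gpC o q p') !ler_norml => /andP[? ?]; apply/andP; split;
  lra.
Qed.

Let orbit_dist g o i k :
  mdist (a (g ^+ i)%g o) (a (g ^+ (i + k))%g o) = mdist (a (g ^+ k)%g o) o.
Proof. exact: mdist_expg. Qed.

Let displacement2 g o : mdist (a (g ^+ 2)%g o) o =
  2 * mdist o (a g o) - 2 * gp o (a g o) (a g^-1%g o).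
Proof.
have D := mdist_invg a g o.
rewrite expg2 actM [mdist _ o]metric_sym (mdist_actV a g o (a g o)).
by rewrite (mdist_gp o (a g^-1%g o)) D (gpC _ (a g o)); lra.
Qed.

(** The orbit of [o] under the powers of [g] is then a quasi-geodesic with
    controlled constants; the bound [4 delta] is the one required for stationary
    sequences. *)
Definition axial o g := 4 * delta < mdist o (a g o) - 2 * gp o (a g o) (a g^-1%g o).

Lemma axialE o g : axial o g =
  (4 * delta < mdist (a (g ^+ 2)%g o) o - mdist (a (g ^+ 1)%g o) o).
Proof.
by rewrite /axial displacement2 expg1 (metric_sym (a g o)); congr (_ < _); lra.
Qed.

Lemma translation_length_axial o g : axial o g ->
  `|translation_length a o g - (mdist o (a g o) - 2 * gp o (a g o) (a g^-1%g o))|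
    <= 2 * delta.
Proof.
move=> ax; have gap := ax; rewrite axialE in gap.
have up := stationary_upper hX delta0 (orbit_dist g o) gap.
have lo := stationary_lower hX delta0 (orbit_dist g o) gap.
have E : mdist (a (g ^+ 2)%g o) o - mdist (a (g ^+ 1)%g o) o =
  mdist o (a g o) - 2 * gp o (a g o) (a g^-1%g o).
  by rewrite displacement2 expg1; metric_lra.
rewrite E in up lo; set s := _ - _ in up lo *.
have cv := @displacement_cvg _ _ _ a g o.
rewrite ler_norml; apply/andP; split.
  rewrite lerBrDl.
  apply: (@cvg_ratio_le _ (fun n => n%:R * (s - 2 * delta)) _ 0 _ _ _ _ cv).
    by move=> n; rewrite addr0.
  exact: cvg_linear_ratio.
rewrite lerBlDl.
apply: (@cvg_ratio_le _ _ (fun n => n%:R * (s + 2 * delta)) _ _ _ up cv).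
exact: cvg_linear_ratio.
Qed.

Lemma mdist_mul o u v :
  mdist o (a (u * v)%g o) =
  mdist o (a u o) + mdist o (a v o) - 2 * gp o (a u^-1%g o) (a v o).
Proof.
have D := mdist_invg a u o.
by rewrite actM mdist_actV (mdist_gp o) D.
Qed.

(** Reading [p], [q], [p'], [q'] as directions of the four ends of the orbits,
    the translation length of a product of two isometries is additive up to the
    cancellations at the two junctions of the cyclic word [u v]. *)
Lemma translation_length_mul (M : R) o u v p q p' q' :
  M + 2 * delta < gp o (a u^-1%g o) p -> M + 2 * delta < gp o (a v o) q ->
  M + 2 * delta < gp o (a u o) p' -> M + 2 * delta < gp o (a v^-1%g o) q' ->
  gp o p q <= M -> gp o p' q' <= M ->
  2 * M + 10 * delta < mdist o (a u o) -> 2 * M + 10 * delta < mdist o (a v o) ->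
  `|translation_length a o (u * v)%g - (mdist o (a u o) + mdist o (a v o)
     - 2 * gp o p q - 2 * gp o p' q')| <= 14 * delta.
Proof.
have d0 := delta0; rewrite gpC (gpC _ _ q) (gpC _ _ p') (gpC _ _ q').
move=> up vq up' vq' pqM pqM' uL vL.
have {up vq}/ler_normlP[j1 j2] :
  `|gp o (a u^-1%g o) (a v o) - gp o p q| <= 2 * delta.
  by apply: (@gp_replace2 M) => //; rewrite gpC.
have {up' vq'}/ler_normlP[k1 k2] :
  `|gp o (a u o) (a v^-1%g o) - gp o p' q'| <= 2 * delta.
  by apply: (@gp_replace2 M) => //; rewrite gpC.
have D := mdist_invg a u o; have D' := mdist_invg a v o.
have uvu : gp o (a u o) (a (u * v)%g o) =
    mdist o (a u o) - gp o (a u^-1%g o) (a v o).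
  by rewrite gp_switch actM -[gp o (a u^-1%g o) _](act_gp a u) actK_inv.
have uvv : gp o (a v^-1%g o) (a (u * v)^-1%g o) =
    mdist o (a v o) - gp o (a u^-1%g o) (a v o).
  rewrite gp_switch D' invgM actM -[gp o (a u^-1%g o) _](act_gp a v^-1%g).
  by rewrite act_invK gpC.
have /ler_normlP[l1 l2] : `|gp o (a (u * v)%g o) (a (u * v)^-1%g o) -
    gp o (a u o) (a v^-1%g o)| <= 2 * delta.
  by apply: (@gp_replace2 (M + 2 * delta)); rewrite ?uvu ?uvv; lra.
have uv := mdist_mul o u v.
have /translation_length_axial/ler_normlP[t1 t2] : axial o (u * v)%g.
  by rewrite /axial uv; lra.
by rewrite uv in t1 t2; apply/ler_normlP; split; lra.
Qed.

(** In this combination the displacements cancel, and so do the junctions that occur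
    in words of opposite signs. *)
Lemma cross_ratio_of_lengths (M : R) o e x y al xi be et :
  0 <= M ->
  4 * M + 20 * delta < gp o (a e^-1%g o) al ->
  4 * M + 20 * delta < gp o (a e o) be ->
  4 * M + 20 * delta < gp o (a x^-1%g o) xi ->
  4 * M + 20 * delta < gp o (a x o) be ->
  4 * M + 20 * delta < gp o (a y^-1%g o) al ->
  4 * M + 20 * delta < gp o (a y o) et ->
  gp o al be <= M -> gp o al et <= M -> gp o xi be <= M -> gp o xi et <= M ->
  `|(translation_length a o (e * x)%g + translation_length a o (e * y)%g
     - translation_length a o (e * (x * y))%g - translation_length a o e)
    - 2 * (gp o al be + gp o xi et - gp o al et - gp o xi be)| <= 52 * delta.
Proof.
have d0 := delta0; move=> M0 e1 e2 x1 x2 y1 y2 Mab Mae Mxb Mxe.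
have weak (t : R) : 4 * M + 20 * delta < t -> M + 2 * delta < t by lra.
have large (t : R) : 4 * M + 20 * delta < t -> 2 * M + 10 * delta < t by lra.
have small (t : R) : 2 * M + 10 * delta < t -> M + 2 * delta < t by lra.
have eL := gp_le o (a e o) be; have xL := gp_le o (a x o) be.
have yL := gp_le o (a y o) et.
have /ler_normlP[i1 i2] : `|gp o (a x^-1%g o) (a y o) - gp o xi et| <= 2 * delta.
  by apply: (@gp_replace2 M); rewrite // gpC; lra.
have /ler_normlP[i3 i4] : `|gp o (a e^-1%g o) (a e o) - gp o al be| <= 2 * delta.
  by apply: (@gp_replace2 M); rewrite // gpC; lra.
have /ler_normlP[t1 t2] : `|translation_length a o e -
    (mdist o (a e o) - 2 * gp o (a e o) (a e^-1%g o))| <= 2 * delta.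
  by apply: translation_length_axial; rewrite /axial (gpC o (a e o)); lra.
rewrite (gpC o (a e o)) in t1 t2.
have xy := mdist_mul o x y.
(* The ends of [x y] point in the directions of [x] and of the inverse of [y]. *)
have xy1 : 2 * M + 10 * delta < gp o (a (x * y)%g o) be.
  have E : gp o (a (x * y)%g o) (a x o) =
      mdist o (a x o) - gp o (a x^-1%g o) (a y o).
    by rewrite gpC gp_switch actM -[gp o (a x^-1%g o) _](act_gp a x) actK_inv.
  by case: (gp_hyp hX o (a (x * y)%g o) (a x o) be); lra.
have xy2 : 2 * M + 10 * delta < gp o (a (x * y)^-1%g o) al.
  have E : gp o (a (x * y)^-1%g o) (a y^-1%g o) =
      mdist o (a y o) - gp o (a x^-1%g o) (a y o).
    rewrite gpC gp_switch metric_sym -mdist_actV invgM actM.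
    by rewrite -[gp o (a x^-1%g o) _](act_gp a y^-1%g) act_invK gpC.
  by case: (gp_hyp hX o (a (x * y)^-1%g o) (a y^-1%g o) al); lra.
have eL' := lt_le_trans e2 eL; have xL' := lt_le_trans x2 xL.
have yL' := lt_le_trans y2 yL.
have xyL := lt_le_trans xy1 (gp_le o (a (x * y)%g o) be).
have Mba : gp o be al <= M by rewrite gpC.
have Mbx : gp o be xi <= M by rewrite gpC.
have /ler_normlP[u1 u2] := translation_length_mul (weak _ e1) (small _ xy1) (weak _ e2)
  (small _ xy2) Mab Mba (large _ eL') xyL.
have /ler_normlP[v1 v2] := translation_length_mul (weak _ e1) (weak _ y2) (weak _ e2)
  (weak _ y1) Mae Mba (large _ eL') (large _ yL').
have /ler_normlP[w1 w2] := translation_length_mul (weak _ e1) (weak _ x2) (weak _ e2)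
  (weak _ x1) Mab Mbx (large _ eL') (large _ xL').
clear weak large small eL eL' xL xL' yL yL' xyL e1 e2 x1 x2 y1 y2 Mab Mae Mxb Mxe.
rewrite (gpC o be al) (gpC o be xi) in u1 u2 v1 v2 w1 w2.
by clear Mba Mbx xy1 xy2; apply/ler_normlP; split; lra.
Qed.

End TranslationLength.

(** * Boundary points and their representatives *)

Section Sequences.
Context {R : realType} {X : metricType R}.
Implicit Types (o p q : X) (x y z : nat -> X) (xi eta : boundary X).

(** A single index is enough to compare sequences already known to converge at
    infinity, and it lets finitely many such facts be combined at one index, where
    they become facts about points. *)
Definition gp_above o (r : R) x y := \forall n \near \oo, r < gp o (x n) (y n).

Lemma gp_aboveC o r x y : gp_above o r x y -> gp_above o r y x.
Proof. by apply: filterS => n; rewrite gpC. Qed.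

Lemma gp_above_le o r s x y : s <= r -> gp_above o r x y -> gp_above o s x y.
Proof. by move=> sr; apply: filterS => n; exact: le_lt_trans. Qed.

Lemma gromov_relatedP x y : gromov_related x y <->
  forall o r, exists N, forall i j, (N <= i)%N -> (N <= j)%N -> r < gp o (x i) (y j).
Proof.
split=> [xy o r|h o].
  have /cvgryPgt/(_ r) := xy o.
  move=> [[P Q] /= [[N1 _ P1] [N2 _ Q2]] PQ]; exists (maxn N1 N2) => i j.
  rewrite !geq_max => /andP[i1 i2] /andP[j1 j2].
  by apply: (PQ (i, j)); split; [exact: P1|exact: Q2].
apply/cvgryPgt => r; have [N hN] := h o r.
exists ([set i | (N <= i)%N], [set j | (N <= j)%N]) => /=.
  by split; exists N.
by move=> [i j] /= [Ni Nj]; exact: hN.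
Qed.

Lemma gromov_related_sym x y : gromov_related x y -> gromov_related y x.
Proof.
move=> /gromov_relatedP h; apply/gromov_relatedP => o r; have [N hN] := h o r.
by exists N => i j Ni Nj; rewrite gpC; exact: hN.
Qed.

Lemma gromov_related_gp_above o r x y : gromov_related x y -> gp_above o r x y.
Proof.
by move=> /gromov_relatedP/(_ o r)[N hN]; exists N => // n /= Nn; exact: hN.
Qed.

Lemma bounded_related C x y : (forall n, mdist (x n) (y n) <= C) ->
  gromov_sequence x -> gromov_related x y.
Proof.
move=> xyC /gromov_relatedP gx; apply/gromov_relatedP => o r.
have [N hN] := gx o (r + C); exists N => i j Ni Nj.
have := hN _ _ Ni Nj; have := gp_lip o (x j) (y j) (x i); have := xyC j.
by rewrite (gpC o (x i)) (gpC o (x i)); lra.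
Qed.

Lemma boundary_nonempty xi : exists x, (\val xi : set (nat -> X)) x.
Proof. by case: xi => /= A /set_mem[x gx ->]; exists x. Qed.

Definition rep xi : nat -> X := sval (cid (boundary_nonempty xi)).

Lemma rep_in xi : (\val xi : set (nat -> X)) (rep xi).
Proof. by rewrite /rep; case: cid. Qed.

Lemma boundary_gromov xi x : (\val xi : set (nat -> X)) x -> gromov_sequence x.
Proof. by case: xi => /= A /set_mem[y gy ->] []. Qed.

Lemma gromov_boundary_pt x : gromov_sequence x ->
  exists xi : boundary X, (\val xi : set (nat -> X)) x.
Proof.
move=> gx; suff xi : gromov_class x \in [set xi | exists2 x : nat -> X,
    gromov_sequence x & xi = gromov_class x].
  by pose e : boundary X := exist _ (gromov_class x) xi; exists e.
by apply/mem_set; exists x.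
Qed.

Lemma boundary_nbhd_near o xi r (b : bordification X) :
  boundary_nbhd o xi r b -> exists x y, [/\ (\val xi : set (nat -> X)) x,
    representatives b y & gp_above o r x y].
Proof.
move=> [x [y [xx yb [[P Q] /= [[N1 _ P1] [N2 _ Q2]] PQ]]]]; exists x, y; split => //.
exists (maxn N1 N2) => // n /=; rewrite geq_max => /andP[n1 n2].
by apply: (PQ (n, n)); split; [exact: P1|exact: Q2].
Qed.

Variable delta : R.
Hypotheses (hX : hyperbolic delta X) (delta0 : 0 <= delta).

Lemma gromov_related_trans y x z :
  gromov_related x y -> gromov_related y z -> gromov_related x z.
Proof.
move=> /gromov_relatedP xy /gromov_relatedP yz; apply/gromov_relatedP => o r.
have [N hN] := xy o (r + delta); have [M hM] := yz o (r + delta).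
exists (maxn N M) => i j; rewrite !geq_max => /andP[i1 i2] /andP[j1 j2].
have := hN i (maxn N M) i1 (leq_maxl _ _).
have := hM (maxn N M) j (leq_maxr _ _) j2.
by case: (gp_hyp hX o (x i) (y (maxn N M)) (z j)); lra.
Qed.

Lemma gp_above_trans o r x y z :
  gp_above o (r + delta) x y -> gp_above o (r + delta) y z -> gp_above o r x z.
Proof.
by apply: filterS2 => n; case: (gp_hyp hX o (x n) (y n) (z n)); lra.
Qed.

Lemma boundary_related xi x y : (\val xi : set (nat -> X)) x ->
  (\val xi : set (nat -> X)) y -> gromov_related x y.
Proof.
case: xi => /= A /set_mem[z gz ->] [_ zx] [_ zy].
by apply: gromov_related_trans (gromov_related_sym zx) zy.
Qed.

Lemma boundary_relatedP xi x : (\val xi : set (nat -> X)) x <->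
  gromov_related (rep xi) x.
Proof.
split; first exact/boundary_related/rep_in.
move=> rx; have gx : gromov_sequence x.
  by apply: gromov_related_trans (gromov_related_sym rx) rx.
move: rx; have := rep_in xi; set y := rep xi; clearbody y; move: y.
case: xi => /= A /set_mem[z gz ->] y [gy zy] rx.
by split=> //; exact: gromov_related_trans zy rx.
Qed.

Lemma boundary_eq xi eta x : (\val xi : set (nat -> X)) x ->
  (\val eta : set (nat -> X)) x -> xi = eta.
Proof.
move=> xx ex; apply/val_inj/seteqP; split=> y yy.
  by apply/boundary_relatedP; apply: (@gromov_related_trans x);
    [exact: (boundary_related (rep_in _))|exact: boundary_related yy].
by apply/boundary_relatedP; apply: (@gromov_related_trans x);
    [exact: (boundary_related (rep_in _))|exact: boundary_related yy].
Qed.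

(** If the Gromov products at a common index are unbounded, one large value is
    propagated to all large pairs of indices by the four-point condition. *)
Lemma related_or_bounded o x y : gromov_sequence x -> gromov_sequence y ->
  gromov_related x y \/ exists M, \forall n \near \oo, gp o (x n) (y n) <= M.
Proof.
move=> /gromov_relatedP gx /gromov_relatedP gy.
have [|nb] := pselect (exists M, \forall n \near \oo, gp o (x n) (y n) <= M).
  by right.
left; apply/gromov_relatedP => o' r.
pose B := r + mdist o o' + 2 * delta; have d0 := delta0.
have [N hN] := gx o B; have [M hM] := gy o B; exists (maxn N M) => i j.
rewrite !geq_max => /andP[i1 i2] /andP[j1 j2].
have [n [n1 n2 Bn]] : exists n, [/\ (N <= n)%N, (M <= n)%N & B < gp o (x n) (y n)].
  apply: contrapT => h; apply: nb; exists B; exists (maxn N M) => // n /=.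
  rewrite geq_max => /andP[n1 n2]; rewrite leNgt; apply/negP => Bn.
  by apply: h; exists n.
have := hN i n i1 n1; have := hM n j n2 j2; have := gp_lip_base o o' (x i) (y j).
rewrite /B in Bn *.
by case: (gp_hyp hX o (x i) (x n) (y j)); case: (gp_hyp hX o (x n) (y n) (y j)); lra.
Qed.

(** The lower limit of the Gromov products along the chosen representatives; for
    distinct points, other representatives or limits change it by a bounded
    amount. *)
Definition gpb o xi eta : R :=
  sup [set r | \forall n \near \oo, r <= gp o (rep xi n) (rep eta n)].

Lemma gpbC o xi eta : gpb o xi eta = gpb o eta xi.
Proof.
by rewrite /gpb; congr sup; apply/funext => r /=; under eq_near do rewrite gpC.
Qed.

Lemma gpb_near o xi eta : xi <> eta ->
  \forall n \near \oo, `|gp o (rep xi n) (rep eta n) - gpb o xi eta| <= 2 * delta.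
Proof.
move=> ne; have d0 := delta0.
have gx := boundary_gromov (rep_in xi); have gy := boundary_gromov (rep_in eta).
have [rel|[M MB]] := related_or_bounded o gx gy.
  case: ne; apply: (boundary_eq (x := rep eta)); last exact: rep_in.
  exact/boundary_relatedP.
have /gromov_relatedP/(_ o (M + 2 * delta))[N1 h1] := gx.
have /gromov_relatedP/(_ o (M + 2 * delta))[N2 h2] := gy.
have [N3 _ h3] := MB; pose N := maxn N1 (maxn N2 N3).
have osc n m : (N <= n)%N -> (N <= m)%N ->
    gp o (rep xi n) (rep eta n) <= gp o (rep xi m) (rep eta m) + 2 * delta.
  rewrite /N !geq_max => /and3P[n1 n2 n3] /and3P[m1 m2 m3].
  have := h1 m n m1 n1; have := h2 n m n2 m2; have := h3 m m3; have := h3 n n3.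
  case: (gp_hyp hX o (rep xi m) (rep xi n) (rep eta m));
    case: (gp_hyp hX o (rep xi n) (rep eta n) (rep eta m)) => /=; lra.
exists N => // n /= Nn.
pose S := [set r | \forall n \near \oo, r <= gp o (rep xi n) (rep eta n)].
have Sn : S (gp o (rep xi n) (rep eta n) - 2 * delta).
  by exists N => // m /= Nm; have := osc n m Nn Nm; lra.
have ub : ubound S (gp o (rep xi n) (rep eta n) + 2 * delta).
  move=> r [K _ hK]; pose m := maxn N K.
  have := hK m (leq_maxr _ _); have := osc m n (leq_maxl _ _) Nn; lra.
have l1 : sup S <= gp o (rep xi n) (rep eta n) + 2 * delta.
  by apply: ge_sup => //; eexists; exact: Sn.
have l2 : gp o (rep xi n) (rep eta n) - 2 * delta <= sup S.
  by apply: ub_le_sup => //; exists (gp o (rep xi n) (rep eta n) + 2 * delta).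
by apply/ler_normlP; rewrite /gpb -/S; split; lra.
Qed.

End Sequences.

(** * Topology of the bordification *)

Section BordificationTopology.
Context {R : realType} {X : metricType R}.
Variable delta : R.
Hypotheses (hX : hyperbolic delta X) (delta0 : 0 <= delta).
Implicit Types (o p q : X) (x y z : nat -> X) (xi eta : boundary X).
Implicit Types (b c : bordification X).

Lemma representatives_gp_above o r b y y' z :
  representatives b y -> representatives b y' ->
  gp_above o (r + delta) z y -> gp_above o r z y'.
Proof.
have d0 := delta0; case: b => [p -> ->|xi yy yy']; first by apply: gp_above_le; lra.
move=> zy; apply: (gp_above_trans hX zy).
exact/gromov_related_gp_above/(boundary_related hX yy yy').
Qed.

Lemma boundary_nbhd_gp_above o xi r b y : boundary_nbhd o xi (r + 2 * delta) b ->
  representatives b y -> gp_above o r (rep xi) y.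
Proof.
move=> /boundary_nbhd_near[x [y' [xx yb xy]]] yb'.
apply: (representatives_gp_above yb yb'); apply: gp_aboveC.
apply: (@representatives_gp_above _ _ (boundary_pt xi) x); [by []|exact: rep_in|].
by apply: gp_aboveC; apply: gp_above_le xy; lra.
Qed.

Lemma gp_above_boundary_nbhd o xi r b y : representatives b y ->
  gp_above o (r + 2 * delta) (rep xi) y -> boundary_nbhd o xi r b.
Proof.
have d0 := delta0; move=> yb xy; exists (rep xi), y; split => //; first exact: rep_in.
have /gromov_relatedP/(_ o (r + 2 * delta))[N1 h1] :=
  boundary_gromov (rep_in xi).
have {yb}[N2 h2] : exists N2, forall n j, (N2 <= n)%N -> (N2 <= j)%N ->
    y n = y j \/ r + 2 * delta < gp o (y n) (y j).
  case: b yb => [p /= ->|eta yy]; first by exists 0%N; left.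
  have /gromov_relatedP/(_ o (r + 2 * delta))[N2 h2] := boundary_gromov yy.
  by exists N2 => n j n2 j2; right; exact: h2.
have [N3 _ h3] := xy; pose n := maxn N1 (maxn N2 N3).
exists ([set i | (n <= i)%N], [set j | (n <= j)%N]); first by split; exists n.
move=> [i j] /= [ni nj].
have n1 : (N1 <= n)%N by rewrite /n; lia.
have n2 : (N2 <= n)%N by rewrite /n; lia.
have n3 : (N3 <= n)%N by rewrite /n; lia.
have k1 := h1 i n (leq_trans n1 ni) n1; have /= k3 := h3 n n3.
have k4 : r + delta < gp o (rep xi i) (y n).
  by case: (gp_hyp hX o (rep xi i) (rep xi n) (y n)); lra.
have [<-|k2] := h2 n j n2 (leq_trans n2 nj); first by lra.
by case: (gp_hyp hX o (rep xi i) (y n) (y j)); lra.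
Qed.

Lemma boundary_nbhd_trans o xi eta r b :
  boundary_nbhd o xi (r + 5 * delta) (boundary_pt eta) ->
  boundary_nbhd o eta (r + 5 * delta) b -> boundary_nbhd o xi r b.
Proof.
have d0 := delta0; move=> xe eb; have [_ [y [_ yb _]]] := eb.
apply: (gp_above_boundary_nbhd yb); apply: (@gp_above_trans _ _ _ hX _ _ _ (rep eta)).
  apply: (@boundary_nbhd_gp_above _ _ _ (boundary_pt eta)); last exact: rep_in.
  by rewrite (_ : _ + 2 * delta = r + 5 * delta) //; lra.
apply: (@boundary_nbhd_gp_above _ _ _ b) yb.
by rewrite (_ : _ + 2 * delta = r + 5 * delta) //; lra.
Qed.

Lemma boundary_nbhd_le o xi r s b : s <= r ->
  boundary_nbhd o xi r b -> boundary_nbhd o xi s b.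
Proof.
move=> sr [x [y [xx yb xy]]]; exists x, y; split => //.
by apply: filterS xy => ij; exact: le_lt_trans.
Qed.

Lemma boundary_nbhd_base o o' xi r b :
  boundary_nbhd o xi (r + mdist o o') b -> boundary_nbhd o' xi r b.
Proof.
move=> [x [y [xx yb xy]]]; exists x, y; split => //.
by apply: filterS xy => ij; have := gp_lip_base o o' (x ij.1) (y ij.2); lra.
Qed.

Lemma boundary_nbhd_interior o xi r p q :
  boundary_nbhd o xi (r + mdist p q) (interior_pt p) ->
  boundary_nbhd o xi r (interior_pt q).
Proof.
move=> [x [y [xx -> xy]]]; exists x, (cst q); split => //.
apply: filterS xy => ij /=; have := gp_lip o p q (x ij.1).
by rewrite (gpC o p) (gpC o q); lra.
Qed.

Lemma boundary_nbhd_self o xi r : boundary_nbhd o xi r (boundary_pt xi).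
Proof.
apply: (@gp_above_boundary_nbhd _ _ _ _ (rep xi)); first exact: rep_in.
exact/gromov_related_gp_above/boundary_gromov/rep_in.
Qed.

(** The interior of this set, defined through balls at interior points and basic
    neighborhoods at boundary points, is open by the four-point condition. *)
Lemma nbhs_boundary o xi r :
  nbhs (boundary_pt xi) (boundary_nbhd o xi r).
Proof.
have d0 := delta0.
set N := boundary_nbhd o xi r.
pose U := [set b : bordification X | match b with
  | inl p => nbhs p [set q | N (interior_pt q)]
  | inr eta => exists s, boundary_nbhd o eta s `<=` N end].
have Uo : open U.
  split.
    rewrite (_ : _ @^-1` U = [set q | N (interior_pt q)]°); last by [].
    exact: open_interior.
  move=> eta [s sN] o'; exists (s + 5 * delta + mdist o' o + 1) => -[p|zeta] h.
    have := nbhsx_ballx p _ (@ltr01 R); rewrite ballEmdist.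
    apply: filterS => q pq; apply: sN; apply: (@boundary_nbhd_interior _ _ _ p).
    apply: (@boundary_nbhd_base o'); apply: boundary_nbhd_le h.
    by move: pq => /=; lra.
  exists (s + 5 * delta) => c cz; apply: sN; apply: boundary_nbhd_trans cz.
  by apply: (@boundary_nbhd_base o'); apply: boundary_nbhd_le h; lra.
have Uxi : U (boundary_pt xi) by exists r.
apply: (@filterS _ _ _ U); last exact: open_nbhs_nbhs.
move=> [p|eta].
  by move=> /nbhs_singleton.
by move=> [s sN]; apply: sN; exact: boundary_nbhd_self.
Qed.

Lemma nbhs_boundary_nbhd o xi (B : set (bordification X)) :
  nbhs (boundary_pt xi) B -> exists r, boundary_nbhd o xi r `<=` B.
Proof.
rewrite nbhsE => -[U [oU Uxi] UB]; have [_ /(_ _ Uxi o)[r rU]] : bordification_open U := oU.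
by exists r; exact: subset_trans UB.
Qed.

Lemma limit_set_gp_above (G : groupType) (a : isometric_action G X) (H : set G) xi :
  limit_set a H (boundary_pt xi) ->
  forall o r, exists2 g, H g & gp_above o r (rep xi) (cst (a g o)).
Proof.
move=> [cl _] o r.
have [_ [[g Hg <-] gxi]] := cl o _ (nbhs_boundary o xi (r + 2 * delta)).
by exists g => //; exact: boundary_nbhd_gp_above gxi _.
Qed.

Lemma ray_gp_above (c : R -> X) xi :
  interior_pt (c t) @[t --> +oo] --> boundary_pt xi ->
  forall o r T, exists2 t, T <= t & gp_above o r (rep xi) (cst (c t)).
Proof.
move=> cv o r T.
have h : \forall t \near +oo, boundary_nbhd o xi (r + 2 * delta) (interior_pt (c t)).
  exact: cv _ (nbhs_boundary o xi (r + 2 * delta)).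
have [t [/= ct Tt]] := filter_ex (filterI h (nbhs_pinfty_ge (num_real T))).
by exists t => //; exact: boundary_nbhd_gp_above ct _.
Qed.

End BordificationTopology.

Definition boundary_continuous {R : realType} {X Y : metricType R}
    (F : boundary X -> boundary Y) :=
  forall xi o o' r', exists r, forall eta, gp_above o r (rep xi) (rep eta) ->
    gp_above o' r' (rep (F xi)) (rep (F eta)).

Section BoundaryMap.
Context {R : realType} {X Y : metricType R}.
Variables (dX dY : R).
Hypotheses (hX : hyperbolic dX X) (dX0 : 0 <= dX).
Hypotheses (hY : hyperbolic dY Y) (dY0 : 0 <= dY).

Lemma continuous_boundary_map (A : set (bordification X)) (B : set (bordification Y))
    (f : A -> B) (F : boundary X -> boundary Y)
    (mA : forall xi, boundary_pt xi \in A) :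
  (forall xi, \val (f (exist _ (boundary_pt xi) (mA xi))) = boundary_pt (F xi)) ->
  continuous f -> boundary_continuous F.
Proof.
move=> fF cf xi o o' r'.
pose x : A := exist _ (boundary_pt xi) (mA xi).
have nY := nbhs_boundary hY dY0 o' (F xi) (r' + 2 * dY).
have nB : nbhs (f x) (\val @^-1` boundary_nbhd o' (F xi) (r' + 2 * dY)).
  by apply: (@initial_continuous _ _ (\val : B -> _)); rewrite fF.
have /= nA : nbhs x (f @^-1` (\val @^-1` boundary_nbhd o' (F xi) (r' + 2 * dY))) :=
  cf x _ nB.
have [V nV VU] : exists2 V, nbhs (boundary_pt xi) V &
    \val @^-1` V `<=` f @^-1` (\val @^-1` boundary_nbhd o' (F xi) (r' + 2 * dY)).
  move: nA; rewrite nbhsE => -[_ [[V oV <-] Vx] VU].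
  by exists V => //; exact: open_nbhs_nbhs.
have [r rV] := nbhs_boundary_nbhd o nV.
exists (r + 2 * dX) => eta xe.
have /VU : (\val @^-1` V) (exist _ (boundary_pt eta) (mA eta) : A).
  by apply: rV; apply: (gp_above_boundary_nbhd hX dX0 _ xe); exact: rep_in.
rewrite /= fF => h; apply: (boundary_nbhd_gp_above hY dY0 h); exact: rep_in.
Qed.

End BoundaryMap.

(** * Dynamics on the boundary *)

Section BoundaryDynamics.
Context {R : realType} {G : groupType} {X : metricType R}.
Variables (a : isometric_action G X) (delta : R).
Hypotheses (hX : hyperbolic delta X) (delta0 : 0 <= delta).
Implicit Types (g h k s u : G) (o p q : X) (x y z : nat -> X).
Implicit Types (xi eta zeta : boundary X) (b c : bordification X).

Lemma act_boundary_in g xi x : (\val xi : set (nat -> X)) x ->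
  (\val (act_boundary a g xi) : set (nat -> X)) (a g \o x).
Proof. by move=> xx; exists x. Qed.

Lemma act_boundary1 xi : act_boundary a 1%g xi = xi.
Proof.
apply: (boundary_eq hX (x := rep xi)); last exact: rep_in.
have := act_boundary_in 1%g (rep_in xi).
by rewrite (_ : _ \o _ = rep xi) //; apply/funext => n /=; rewrite act1.
Qed.

Lemma act_boundaryM g h xi :
  act_boundary a (g * h)%g xi = act_boundary a g (act_boundary a h xi).
Proof.
apply: (boundary_eq hX (x := a (g * h)%g \o rep xi)).
  exact/act_boundary_in/rep_in.
rewrite (_ : _ \o _ = a g \o (a h \o rep xi)); last first.
  by apply/funext => n /=; rewrite actM.
exact/act_boundary_in/act_boundary_in/rep_in.
Qed.

Lemma act_boundary_invK g : cancel (act_boundary a g) (act_boundary a g^-1%g).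
Proof. by move=> xi; rewrite -act_boundaryM mulVg act_boundary1. Qed.

Lemma act_boundaryK_inv g : cancel (act_boundary a g^-1%g) (act_boundary a g).
Proof. by move=> xi; rewrite -act_boundaryM mulgV act_boundary1. Qed.

Lemma act_boundary_inj g : injective (act_boundary a g).
Proof. exact: can_inj (act_boundary_invK g). Qed.

Lemma rep_act_above o r g xi :
  gp_above o r (rep (act_boundary a g xi)) (a g \o rep xi).
Proof.
apply/gromov_related_gp_above/(boundary_related hX); first exact: rep_in.
exact/act_boundary_in/rep_in.
Qed.

Lemma representatives_cauchy o (r : R) b x : representatives b x ->
  exists N, forall n m, (N <= n)%N -> (N <= m)%N ->
    x n = x m \/ r < gp o (x n) (x m).
Proof.
case: b => [p ->|xi xx]; first by exists 0%N; left.
have /gromov_relatedP/(_ o r)[N h] := boundary_gromov xx.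
by exists N => n m Nn Nm; right; exact: h.
Qed.

(** For convergent or constant sequences, Gromov products that are large infinitely
    often are large eventually. This permits arguments by contradiction with
    finitely many points at a single index. *)
Lemma gp_above_or o r b c x y : representatives b x -> representatives c y ->
  gp_above o r x y \/ \forall n \near \oo, gp o (x n) (y n) <= r + 2 * delta.
Proof.
have d0 := delta0; move=> bx cy.
have [|nb] := pselect (\forall n \near \oo, gp o (x n) (y n) <= r + 2 * delta).
  by right.
left; have [N1 h1] := representatives_cauchy o (r + 2 * delta) bx.
have [N2 h2] := representatives_cauchy o (r + 2 * delta) cy.
have [n [n1 n2 xyn]] : exists n, [/\ (N1 <= n)%N, (N2 <= n)%N &
    r + 2 * delta < gp o (x n) (y n)].
  apply: contrapT => h; apply: nb; exists (maxn N1 N2) => // n /=.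
  rewrite geq_max => /andP[n1 n2]; rewrite leNgt; apply/negP => Bn.
  by apply: h; exists n.
exists (maxn N1 N2) => // m /=; rewrite geq_max => /andP[m1 m2].
have k1 : r + delta < gp o (x m) (y n).
  have [->|h] := h1 m n m1 n1; first by lra.
  by case: (gp_hyp hX o (x m) (x n) (y n)); lra.
have [<-|h] := h2 n m n2 m2; first by lra.
by case: (gp_hyp hX o (x m) (y n) (y m)); lra.
Qed.

Lemma gpb_bounded o xi eta : xi <> eta ->
  exists2 M : R, 0 <= M & \forall n \near \oo, gp o (rep xi n) (rep eta n) <= M.
Proof.
move=> ne; exists (Num.max 0 (gpb o xi eta + 2 * delta)).
  by rewrite le_max lexx.
apply: filterS (gpb_near hX delta0 o ne) => n /ler_normlP[_ h].
by rewrite le_max; apply/orP; right; lra.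
Qed.

(** This is what membership of [xi] in the limit set of [S] gives. *)
Definition orbit_limit (S : set G) xi := forall o r,
  exists2 g, S g & gp_above o r (rep xi) (cst (a g o)).

(** If [k o] is close to [xi], then [k] maps close to [xi] all boundary points
    except those close to the direction of the inverse orbit point, hence at
    least one of two given ones. *)
Lemma orbit_pair_above xi zeta1 zeta2 o (r M : R) k : 0 <= M ->
  (\forall n \near \oo, gp o (rep zeta1 n) (rep zeta2 n) <= M) ->
  gp_above o (`|r| + M + 10 * delta) (rep xi) (cst (a k o)) ->
  gp_above o r (rep xi) (rep (act_boundary a k zeta1)) \/
  gp_above o r (rep xi) (rep (act_boundary a k zeta2)).
Proof.
have d0 := delta0; move=> M0 hM; set B := _ + 10 * delta => hk.
have rB : r <= `|r| := ler_norm r.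
have repB xi' : representatives (boundary_pt xi') (rep xi') by exact: rep_in.
have [|b1] := gp_above_or o r (repB xi) (repB (act_boundary a k zeta1)); first by left.
have [|b2] := gp_above_or o r (repB xi) (repB (act_boundary a k zeta2)); first by right.
have t1 := rep_act_above o B k zeta1; have t2 := rep_act_above o B k zeta2.
have [n [[[[[Mn kn] b1n] b2n] t1n] t2n]] := filter_ex
  (filterI (filterI (filterI (filterI (filterI hM hk) b1) b2) t1) t2).
rewrite /= in Mn kn b1n b2n t1n t2n.
have kL := gp_le o (a k o) (rep xi n); rewrite (gpC o (a k o)) in kL.
have step zeta : B < gp o (rep (act_boundary a k zeta) n) (a k (rep zeta n)) ->
    gp o (a k^-1%g o) (rep zeta n) <= M + delta ->
    r + 2 * delta < gp o (rep xi n) (rep (act_boundary a k zeta) n).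
  move=> h1 h2; have := gp_act_base a k o (rep zeta n); rewrite gpC in h1.
  case: (gp_hyp hX o (rep xi n) (a k o) (rep (act_boundary a k zeta) n));
  case: (gp_hyp hX o (a k o) (a k (rep zeta n)) (rep (act_boundary a k zeta) n));
  rewrite /B in kn h1; lra.
have := step zeta1 t1n; have := step zeta2 t2n.
case: (gp_hyp hX o (rep zeta1 n) (a k^-1%g o) (rep zeta2 n)).
  rewrite (gpC o (rep zeta1 n) (a _ _)) => h _ /(_ ltac:(lra)); lra.
by move=> h /(_ ltac:(lra)); lra.
Qed.

Definition power_limit g o xi :=
  (\val xi : set (nat -> X)) (fun n => a (g ^+ n)%g o).

Lemma boundary_bounded xi x y C : (\val xi : set (nat -> X)) x ->
  (forall n, mdist (x n) (y n) <= C) -> (\val xi : set (nat -> X)) y.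
Proof.
move=> xx xy; apply/(boundary_relatedP hX).
apply: (gromov_related_trans hX (boundary_related hX (rep_in _) xx)).
exact: bounded_related xy (boundary_gromov xx).
Qed.

Lemma power_limit_fixed g h o xi : power_limit g o xi ->
  commute g h -> act_boundary a h xi = xi.
Proof.
move=> gxi gh; apply: (boundary_eq hX (act_boundary_in h gxi)).
apply: (boundary_bounded (C := mdist o (a h o)) gxi) => n /=.
have -> : a h (a (g ^+ n)%g o) = a (g ^+ n)%g (a h o).
  by rewrite -!actM -(commuteX n (commute_sym gh)).
by rewrite act_isometry.
Qed.

Lemma axial_limit o g : axial a delta o g -> exists xi, power_limit g o xi.
Proof.
have d0 := delta0; rewrite axialE => gap.
have orbit_dist i n : mdist (a (g ^+ i)%g o) (a (g ^+ (i + n))%g o) =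
  mdist (a (g ^+ n)%g o) o by exact: mdist_expg.
have grow := stationary_gp hX delta0 orbit_dist gap.
rewrite expg0 act1 in grow.
set e := _ - 2 * delta in grow; have e0 : 0 < e by rewrite /e; lra.
apply: gromov_boundary_pt; apply/gromov_relatedP => q r.
have [N _ hN] := nbhs_infty_gtr ((r + mdist o q) / e); exists N => i j Ni Nj.
wlog ij : i j Ni Nj / (i <= j)%N.
  move=> H; case/orP: (leq_total i j) => ij; first exact: H.
  by rewrite gpC; exact: H.
have := gp_lip_base o q (a (g ^+ i)%g o) (a (g ^+ j)%g o).
have := grow i (j - i)%N; rewrite subnKC//.
by have := hN i Ni; rewrite /= ltr_pdivrMr//; lra.
Qed.

Lemma axialV o g : axial a delta o g -> axial a delta o g^-1%g.
Proof. by rewrite /axial mdist_invg invgK gpC. Qed.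

Lemma axial_limits o g : axial a delta o g ->
  exists xi eta, [/\ power_limit g o xi, power_limit g^-1%g o eta & xi <> eta].
Proof.
move=> ax; have [xi gxi] := axial_limit ax; have [eta geta] := axial_limit (axialV ax).
exists xi, eta; split => // xieta; move: ax; rewrite axialE => gap.
have orbit_dist i n : mdist (a (g ^+ i)%g o) (a (g ^+ (i + n))%g o) =
  mdist (a (g ^+ n)%g o) o by exact: mdist_expg.
have := stationary_opposite hX delta0 orbit_dist gap; rewrite expg0 act1.
set B := _ + 2 * delta => opp.
rewrite -xieta in geta.
have /gromov_relatedP/(_ o B)[N hN] := boundary_related hX geta gxi.
have := hN N.+1 N.+1 (leqnSn _) (leqnSn _).
rewrite expVgn -(act_gp a (g ^+ N.+1)%g) actK_inv -actM -expgnDr.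
by have := opp N N; lra.
Qed.

(** If the displacement of [g^n] is close to [n] times the length, it increases by a
    definite proportion of [n] between [g^n] and [g^(2n)]. *)
Lemma translation_length_gap o g : 0 < translation_length a o g ->
  exists n, axial a delta o (g ^+ n)%g.
Proof.
move=> l0; have cv := @displacement_cvg _ _ _ a g o.
set l := translation_length a o g in l0.
have l60 : 0 < l / 6 by rewrite divr_gt0.
have /cvgrPdist_le/(_ _ l60)[N1 _ h1] := cv.
have [N2 _ h2] := nbhs_infty_gtr (8 * delta / l).
pose n := maxn 1 (maxn N1 N2); exists n; rewrite axialE expg1 -expgnA.
have n0 : 0 < n%:R :> R by rewrite ltr0n /n; lia.
have k1 := h1 n ltac:(rewrite /n /=; lia).
have k2 := h1 (n * 2)%N ltac:(rewrite /n /=; lia).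
have k3 := h2 n ltac:(rewrite /n /=; lia).
move: k1 k2 k3; rewrite /= -/(translation_length a o g) -/l natrM.
have n20 : 0 < n%:R * 2 :> R by rewrite mulr_gt0.
set A := mdist _ _; set A2 := mdist _ _.
move=> /ler_normlP[k1 _] /ler_normlP[_ k2]; rewrite ltr_pdivrMr// => k3.
have {}k1 : A <= 7 / 6 * l * n%:R by rewrite -ler_pdivrMr//; lra.
have {}k2 : 5 / 6 * l * (n%:R * 2) <= A2 by rewrite -ler_pdivlMr//; lra.
have : 8 * delta < l * n%:R by lra.
move: k1 k2; set t := l * n%:R.
have -> : 7 / 6 * l * n%:R = 7 / 6 * t by rewrite /t; lra.
have -> : 5 / 6 * l * (n%:R * 2) = 10 / 6 * t by rewrite /t; lra.
lra.
Qed.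

Lemma orbit_limit_pair (S : set G) xi zeta1 zeta2 : orbit_limit S xi ->
  zeta1 <> zeta2 -> forall o r, exists2 k, S k &
    gp_above o r (rep xi) (rep (act_boundary a k zeta1)) \/
    gp_above o r (rep xi) (rep (act_boundary a k zeta2)).
Proof.
move=> acc ne o r; have [M M0 hM] := gpb_bounded o ne.
by have [k Sk hk] := acc o (`|r| + M + 10 * delta); exists k => //;
  exact: orbit_pair_above hM hk.
Qed.

(** The fixed points are the limits of the forward and backward powers of an axial
    power of [g]. *)
Lemma hyperbolic_fixed o g : 0 < translation_length a o g ->
  exists xi eta, [/\ act_boundary a g xi = xi, act_boundary a g eta = eta &
    xi <> eta].
Proof.
move=> /translation_length_gap[n ax].
have [xi [eta [gxi geta ne]]] := axial_limits ax; exists xi, eta; split => //.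
  by apply: (power_limit_fixed gxi); exact/commute_sym/commuteX.
apply: (power_limit_fixed geta).
by apply/commute_sym/commuteV; exact/commuteX.
Qed.

(** An isometry moving [o] a lot is axial unless it and its inverse move [o] in the
    same direction [zeta]. If some [s] in [H] moves [zeta], composing with [s]
    separates the two directions. If [H] fixes [zeta], an element moving [o]
    towards another point has an inverse moving it towards [zeta]. *)
Lemma exists_axial (H : groupClosed G) o :
  (forall xi, orbit_limit [set` H] xi) -> (exists xi eta : boundary X, xi <> eta) ->
  exists2 k, k \in H & axial a delta o k.
Proof.
have d0 := delta0; move=> acc [zeta [xi ne]].
have [[s Hs sz]|fix_zeta] := pselect (exists2 s, s \in H &
    act_boundary a s zeta <> zeta).
  have [M M0 hM] := gpb_bounded o sz.
  have s0 := mdist_ge0 o (a s o).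
  pose B := 2 * M + 6 * mdist o (a s o) + 20 * delta + 1.
  have [u Hu hu] := acc zeta o B.
  apply: contrapT => nax.
  have {}nax k : k \in H ->
      mdist o (a k o) - 2 * gp o (a k o) (a k^-1%g o) <= 4 * delta.
    by move=> Hk; rewrite leNgt; apply/negP => ax; apply: nax; exists k.
  have n1 := nax u Hu; have n2 := nax (s * u)%g (gpredM _ _ Hs Hu).
  have [n [[hMn hun] sn]] := filter_ex (filterI (filterI hM hu)
    (rep_act_above o B s zeta)).
  rewrite /= in hMn hun sn.
  have uL := gp_le o (a u o) (rep zeta n); rewrite (gpC o (a u o)) in uL.
  have su := metric_triangle o (a s^-1%g o) (a u o).
  rewrite mdist_invg in su; have sud := mdist_actV a s o (a u o).
  rewrite -actM in sud.
  have suV : mdist (a (s * u)^-1%g o) (a u^-1%g o) = mdist o (a s o).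
    by rewrite invgM actM act_isometry metric_sym mdist_invg.
  have l1 := gp_lip o (a (s * u)^-1%g o) (a u^-1%g o) (a (s * u)%g o).
  rewrite suV in l1.
  have l2 := gp_lip_base o (a s^-1%g o) (a u o) (rep zeta n).
  rewrite -gp_actV -actM mdist_invg in l2.
  have : M + 1 / 4 <= gp o (rep zeta n) (rep (act_boundary a s zeta) n).
    apply: (gp_trans hX (r := a u o)); first by rewrite /B in hun; lra.
    apply: (gp_trans hX (r := a u^-1%g o)); first by rewrite /B in hun; lra.
    apply: (gp_trans hX (r := a (s * u)%g o)).
      by rewrite (gpC _ (a (s * u)%g o)) in n2; rewrite /B in hun; lra.
    apply: (gp_trans hX (r := a s (rep zeta n))).
      by rewrite (gpC o (a u o)) in l2; rewrite /B in hun; lra.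
    by rewrite gpC; rewrite /B in sn; lra.
  by rewrite gpC; lra.
have {}fix_zeta s : s \in H -> act_boundary a s zeta = zeta.
  by move=> Hs; apply: contrapT => sz; apply: fix_zeta; exists s.
have [M M0 hM] := gpb_bounded o ne.
pose B := 2 * M + 20 * delta + 1.
have [u Hu hu] := acc xi o B; exists u => //; rewrite /axial ltNge; apply/negP => nax.
have [n [[hMn hun] un]] := filter_ex (filterI (filterI hM hu)
  (rep_act_above o B u zeta)).
rewrite fix_zeta // in un; rewrite /= in hMn hun un.
have uL := gp_le o (a u o) (rep xi n); rewrite (gpC o (a u o)) in uL.
have ub : gp o (rep zeta n) (a u o) <= M + delta.
  rewrite leNgt; apply/negP => h.
  have : M < gp o (rep zeta n) (rep xi n); last by lra.
  by case: (gp_hyp hX o (rep zeta n) (a u o) (rep xi n));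
    rewrite 1?(gpC o (a u o)) /B in hun *; lra.
have base := gp_act_base a u o (rep zeta n).
have ub2 : gp o (a u o) (a u (rep zeta n)) <= M + 2 * delta.
  rewrite leNgt; apply/negP => h.
  have : M + delta < gp o (rep zeta n) (a u o); last by lra.
  by case: (gp_hyp hX o (rep zeta n) (a u (rep zeta n)) (a u o));
    rewrite ?(gpC o (a u (rep zeta n))) /B in un *; lra.
have : M + delta + 1 / 4 <= gp o (a u o) (rep zeta n).
  apply: (gp_trans hX (r := a u^-1%g o)); rewrite /B in hun; lra.
by rewrite gpC; lra.
Qed.

End BoundaryDynamics.

(** * Visibility by rough geodesics *)

Definition three_points (T : Type) := exists x y z : T, [/\ x <> y, y <> z & x <> z].

Lemma rough_geodesic_position {R : realType} {X : metricType R} (K t : R) (u v z : X) :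
  roughly_geodesic K X -> `|2 * t + mdist u z - mdist v z| <= mdist u v - K ->
  exists y, gp y u v <= 3 / 2 * K /\ `|gp y u z - gp y v z - t| <= K.
Proof.
move=> geod /ler_normlP[h1 h2]; have [e [f [c [ef geo ce cf]]]] := geod u v.
have eE : e \in `[e, f] by rewrite in_itv /= lexx.
have fE : f \in `[e, f] by rewrite in_itv /= lexx andbT.
have := geo _ _ eE fE; rewrite ce cf (ler0_norm (_ : e - f <= 0)); last by lra.
case/ler_normlP => ef1 ef2; pose s := (e + f + 2 * t + mdist u z - mdist v z) / 2.
have sE : s \in `[e, f] by rewrite in_itv /= /s; apply/andP; split; lra.
have /andP[es sf] : e <= s <= f by rewrite in_itv in sE.
have := geo _ _ eE sE; rewrite ce (ler0_norm (_ : e - s <= 0)); last by lra.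
have := geo _ _ sE fE; rewrite cf (ler0_norm (_ : s - f <= 0)); last by lra.
have sd : 2 * s = e + f + 2 * t + mdist u z - mdist v z by rewrite /s; lra.
move=> /ler_normlP[v1 v2] /ler_normlP[u1 u2]; exists (c s).
by clear eE fE sE; clearbody s; split; [|apply/ler_normlP; split];
  rewrite /gp; metric_lra.
Qed.

Section OneSpace.
Context {R : realType} {G : groupType} {X : metricType R}.
Variables (a : isometric_action G X) (delta : R).
Hypotheses (hX : hyperbolic delta X) (delta0 : 0 <= delta).
Implicit Types (g h k s u : G) (o p q : X) (x y z : nat -> X).
Implicit Types (xi eta zeta alpha beta : boundary X).

Lemma boundary_pt_inj : injective (@boundary_pt R X).
Proof. by move=> xi eta []. Qed.

(** In the non-elementary case, the two fixed points of one hyperbolic element and a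
    fixed point of the other one. *)
Lemma three_boundary_points :
  non_elementary a \/ quasi_parabolic a -> three_points (boundary X).
Proof.
case=> [[g [h [[og lg] [oh lh] dis]]]|[_ _ [b1 [b2 [b3 [l1 l2 l3 [n12 n23 n13]]]]]]].
  have [xi [eta [gxi geta ne]]] := hyperbolic_fixed hX delta0 lg.
  have [zeta [_ [hz _ _]]] := hyperbolic_fixed hX delta0 lh.
  have nfix xi' : act_boundary a g xi' = xi' -> zeta <> xi'.
    move=> gx zx; suff : (boundary_fixed_points a g `&` boundary_fixed_points a h)
      (boundary_pt zeta) by rewrite dis.
    by split; split; [exists zeta|rewrite /= zx gx|exists zeta|rewrite /= hz].
  exists xi, zeta, eta; split => //; last exact: nfix.
  exact/nesym/nfix.
have [[_ [x1 _ e1]] [_ [x2 _ e2]] [_ [x3 _ e3]]] := And3 l1 l2 l3.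
by exists x1, x2, x3; split => e; [apply: n12|apply: n23|apply: n13];
  rewrite -?e1 -?e2 -?e3 e.
Qed.

Lemma boundary_seq_above o r xi beta x : (\val xi : set (nat -> X)) x ->
  gp_above o (r + 2 * delta) (rep beta) (rep xi) ->
  \forall n \near \oo, gp_above o r (rep beta) (cst (x n)).
Proof.
have d0 := delta0; move=> xx bx.
have /gromov_relatedP/(_ o (r + delta))[N hN] := boundary_related hX (rep_in xi) xx.
exists N => // n /= Nn; move: bx (nbhs_infty_ge N); apply: filterS2 => i bi Ni /=.
have := hN i n Ni Nn.
by case: (gp_hyp hX o (rep beta i) (rep xi i) (x n)); lra.
Qed.

Definition dense_orbits (H : groupClosed G) := forall tau xi o r,
  exists2 s, s \in H & gp_above o r (rep xi) (rep (act_boundary a s tau)).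

(** The pairs of limits of the orbits of [e] and of its inverse, for [e] in a double
    coset of [H], form a set invariant under [H] in each coordinate separately, and
    [u k^n] provides one pair. *)
Lemma double_coset_ends (H : groupClosed G) k u o kp km :
  dense_orbits H -> k \in H -> power_limit a k o kp -> power_limit a k^-1%g o km ->
  forall beta alpha r, exists s s', [/\ s \in H, s' \in H,
    gp_above o r (rep beta) (cst (a (s * u * s')%g o)) &
    gp_above o r (rep alpha) (cst (a (s * u * s')^-1%g o))].
Proof.
move=> dense Hk kkp kkm beta alpha r.
have [s Hs hs] := dense (act_boundary a u kp) beta o (r + 2 * delta).
have [t Ht ht] := dense km alpha o (r + 2 * delta).
have k1 : (\val (act_boundary a s (act_boundary a u kp)) : set (nat -> X))
    (fun n => a (s * u * (k ^+ n * t^-1))%g o).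
  apply: (boundary_bounded (C := mdist o (a t^-1%g o)) hX
    (act_boundary_in a s (act_boundary_in a u kkp))) => n /=.
  by rewrite !actM !act_isometry.
have k2 : (\val (act_boundary a t km) : set (nat -> X))
    (fun n => a (s * u * (k ^+ n * t^-1))^-1%g o).
  apply: (boundary_bounded (C := mdist o (a (s * u)^-1%g o)) hX
    (act_boundary_in a t kkm)) => n /=.
  have -> : (s * u * (k ^+ n * t^-1))^-1%g = (t * (k^-1 ^+ n * (s * u)^-1))%g.
    by rewrite expVgn invgM [(k ^+ n * _)^-1%g]invgM invgK mulgA.
  by rewrite !actM !act_isometry.
have [n [n1 n2]] := filter_ex (filterI (boundary_seq_above k1 hs)
  (boundary_seq_above k2 ht)).
exists s, (k ^+ n * t^-1)%g; split => //.
by rewrite gpredM ?gpredV// gpredXn.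
Qed.

(** Coarse centers of the same tripod are close: from each of [o] and [y], the other
    point is away from at least two of the three ends, hence both from a common
    one. *)
Lemma tripod_dist (o y u v z : X) (M N : R) :
  gp o u v <= M -> gp o u z <= M -> gp o v z <= M ->
  gp y u v <= N -> gp y u z <= N -> gp y v z <= N ->
  mdist o y <= M + N + 2 * delta.
Proof.
have two (q w : X) (C : R) : gp q u v <= C -> gp q u z <= C -> gp q v z <= C ->
  [\/ gp q u w <= C + delta /\ gp q v w <= C + delta,
      gp q u w <= C + delta /\ gp q z w <= C + delta |
      gp q v w <= C + delta /\ gp q z w <= C + delta].
  move=> h1 h2 h3; case: (gp_hyp hX q u w v); case: (gp_hyp hX q u w z);
    case: (gp_hyp hX q v w z); rewrite ?(gpC q w) => *;
    first [by apply: Or31; split; lra | by apply: Or32; split; lra |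
           by apply: Or33; split; lra].
move=> o1 o2 o3 y1 y2 y3; have su (w : X) : gp o w y = mdist o y - gp y w o.
  by rewrite gpC gp_switch (gpC y).
have := su u; have := su v; have := su z.
by case: (two o y M o1 o2 o3) => -[? ?]; case: (two y o N y1 y2 y3) => -[? ?]; lra.
Qed.

(** Every point lies coarsely between two boundary points: with [g] a large power
    of an axial isometry, a rough ray through [p] and [g p] leaves away from one
    of them, whereas the inverse orbit of [g] leaves on the other side. *)
Lemma coarse_bi_infinite (K : R) o k kp km : 0 < K -> roughly_complete K X ->
  power_limit a k o kp -> power_limit a k^-1%g o km ->
  forall p, exists xi eta, xi <> eta /\
    \forall n \near \oo, gp p (rep xi n) (rep eta n) <= 3 / 2 * K + 3 * delta.
Proof.
have d0 := delta0; move=> K0 complete kkp kkm p.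
pose B := 3 / 2 * K + 10 * delta.
have limit_p l xi : power_limit a l o xi ->
    \forall n \near \oo, gp_above p B (rep xi) (cst (a (l ^+ n)%g p)).
  move=> lxi; apply: (@boundary_seq_above _ _ xi).
    by apply: (boundary_bounded (C := mdist o p) hX lxi) => n /=;
      rewrite act_isometry.
  exact/gromov_related_gp_above/boundary_gromov/rep_in.
have [n [np nm]] := filter_ex (filterI (limit_p _ _ kkp) (limit_p _ _ kkm)).
rewrite expVgn in nm; set g := (k ^+ n)%g in np nm.
have distinct xi eta : (\forall m \near \oo,
    gp p (rep xi m) (rep eta m) <= 3 / 2 * K + 3 * delta) -> xi <> eta.
  move=> h e; have self := gromov_related_gp_above p B (boundary_gromov (rep_in eta)).
  rewrite e in h; have [m [/= h1 h2]] := filter_ex (filterI h self).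
  by rewrite /B in h2; lra.
have [c [xi [s [t [[geo lim] s0 t0 cs ct]]]]] := complete p (a g p).
have ray (u : R) : 0 <= u -> u \in `[0, +oo[ by rewrite in_itv /= andbT.
have ps := geo _ _ (ray _ s0) (ray _ t0); rewrite cs ct in ps.
(* Whichever of [p] and [g p] comes first on the ray, the ray avoids it after
   passing through the other one. *)
have [st|ts] := leP s t.
  have [T tT cT] := ray_gp_above hX delta0 lim (a g p) B t.
  have sT := geo _ _ (ray _ s0) (ray _ (le_trans t0 tT)).
  have tT' := geo _ _ (ray _ t0) (ray _ (le_trans t0 tT)).
  rewrite cs in sT; rewrite ct in tT'.
  have pc : gp (a g p) p (c T) <= 3 / 2 * K.
    move: ps sT tT'; rewrite (ler0_norm (_ : s - t <= 0)); last by lra.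
    rewrite (ler0_norm (_ : s - T <= 0)); last by lra.
    rewrite (ler0_norm (_ : t - T <= 0)); last by lra.
    move=> /ler_normlP[? ?] /ler_normlP[? ?] /ler_normlP[? ?].
    by rewrite /gp; metric_lra.
  suff h : \forall m \near \oo, gp p (rep km m)
      (rep (act_boundary a g^-1%g xi) m) <= 3 / 2 * K + 3 * delta.
    by exists km, (act_boundary a g^-1%g xi); split; [exact: distinct|].
  have rg := rep_act_above a hX p B g^-1%g xi.
  apply: filterS (filterI (filterI cT nm) rg) => m [[/= m1 m2] m3].
  have e1 : gp p (a g^-1%g p) (a g^-1%g (rep xi m)) = gp (a g p) p (rep xi m).
    by rewrite gp_actV invgK.
  rewrite leNgt; apply/negP => h.
  have h1 : 3 / 2 * K + 2 * delta < gp p (a g^-1%g p) (rep (act_boundary a g^-1%g xi) m).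
    by case: (gp_hyp hX p (a g^-1%g p) (rep km m) (rep (act_boundary a g^-1%g xi) m));
      rewrite ?(gpC p (a g^-1%g p) (rep km m)); rewrite /B in m2; lra.
  have h2 : 3 / 2 * K + delta < gp p (a g^-1%g p) (a g^-1%g (rep xi m)).
    by case: (gp_hyp hX p (a g^-1%g p) (rep (act_boundary a g^-1%g xi) m)
      (a g^-1%g (rep xi m))); rewrite /B in m3; lra.
  by case: (gp_hyp hX (a g p) p (rep xi m) (c T)); rewrite /B in m1; lra.
have [T sT' cT] := ray_gp_above hX delta0 lim p B s.
have sT := geo _ _ (ray _ s0) (ray _ (le_trans s0 sT')).
have tT := geo _ _ (ray _ t0) (ray _ (le_trans s0 sT')).
rewrite cs in sT; rewrite ct in tT.
have pc : gp p (a g p) (c T) <= 3 / 2 * K.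
  move: ps sT tT; rewrite (gtr0_norm (_ : 0 < s - t)); last by lra.
  rewrite (ler0_norm (_ : s - T <= 0)); last by lra.
  rewrite (ler0_norm (_ : t - T <= 0)); last by lra.
  move=> /ler_normlP[? ?] /ler_normlP[? ?] /ler_normlP[? ?].
  by rewrite /gp; metric_lra.
suff h : \forall m \near \oo, gp p (rep kp m) (rep xi m) <= 3 / 2 * K + 3 * delta.
  by exists kp, xi; split; [exact: distinct|].
apply: filterS (filterI cT np) => m [/= m1 m2].
rewrite leNgt; apply/negP => h.
have h1 : 3 / 2 * K + 2 * delta < gp p (a g p) (rep xi m).
  by case: (gp_hyp hX p (a g p) (rep kp m) (rep xi m));
    rewrite ?(gpC p (a g p) (rep kp m)); rewrite /B in m2; lra.
by case: (gp_hyp hX p (a g p) (rep xi m) (c T)); rewrite /B in m1; lra.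
Qed.

End OneSpace.

(** The position on a line from [u] to [v] is prescribed relatively to the
    projection of [z]. A rough geodesic is used between points close to [u] and
    [v]; the distance from [o] to the chosen point is bounded in terms of [t]
    only, so that these points can be taken so close to [u] and [v] that they can
    be replaced by them. *)
Lemma point_on_line {R : realType} {X : metricType R} (delta K t : R)
    (u v z : boundary X) (o : X) : hyperbolic delta X -> 0 <= delta -> 0 < K ->
  roughly_geodesic K X -> u <> v -> u <> z -> v <> z -> exists y : X,
    gpb y u v <= 2 * K + 4 * delta /\
    `|gpb y u z - gpb y v z - t| <= K + 8 * delta.
Proof.
move=> hX d0 K0 geod uv uz vz.
have [M1 M1_0 h1] := gpb_bounded hX d0 o uv.
have [M2 M2_0 h2] := gpb_bounded hX d0 o uz.
have [M3 M3_0 h3] := gpb_bounded hX d0 o vz.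
pose M := M1 + M2 + M3; pose N := 3 * K + delta + `|t|; have t0 := normr_ge0 t.
have N0 : 0 <= N by rewrite /N; lra.
pose B := M + N + 2 * delta.
have cauchy xi : exists n0, forall i j, (n0 <= i)%N -> (n0 <= j)%N ->
    B + 2 * M + N + K + `|t| + 10 * delta < gp o (rep xi i) (rep xi j).
  by have /gromov_relatedP := boundary_gromov (rep_in xi); exact.
have [[n1 c1] [n2 c2] [n3 c3]] := And3 (cauchy u) (cauchy v) (cauchy z).
have [n [[[b1 b2] b3] ge]] := filter_ex (filterI (filterI (filterI h1 h2) h3)
  (nbhs_infty_ge (maxn n1 (maxn n2 n3)))).
rewrite /= !geq_max in ge; case/and3P: ge => ge1 ge2 ge3.
have {h1 h2 h3} [bM1 bM2 bM3] : [/\ gp o (rep u n) (rep v n) <= M,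
    gp o (rep u n) (rep z n) <= M & gp o (rep v n) (rep z n) <= M].
  by rewrite /M; split; lra.
have [y [y1 y2]] : exists y, gp y (rep u n) (rep v n) <= 3 / 2 * K /\
    `|gp y (rep u n) (rep z n) - gp y (rep v n) (rep z n) - t| <= K.
  apply: rough_geodesic_position => //.
  have dU := lt_le_trans (c1 n n ge1 ge1) (gp_le _ _ _).
  have dV := lt_le_trans (c2 n n ge2 ge2) (gp_le _ _ _).
  have uvz := gp_ge0 o (rep v n) (rep z n); have uzz := gp_ge0 o (rep u n) (rep z n).
  have /andP[t1 t2] : - `|t| <= t <= `|t| by rewrite -ler_norml.
  rewrite !(mdist_gp o (rep _ n)); apply/ler_normlP.
  by clear b1 b2 b3; rewrite /B in dU dV; split; lra.
have {}y2 : gp y (rep u n) (rep z n) - gp y (rep v n) (rep z n) <= `|t| + K /\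
    gp y (rep v n) (rep z n) - gp y (rep u n) (rep z n) <= `|t| + K /\
    `|gp y (rep u n) (rep z n) - gp y (rep v n) (rep z n) - t| <= K.
  have /andP[t1 t2] : - `|t| <= t <= `|t| by rewrite -ler_norml.
  by move: (y2) => /ler_normlP[? ?]; do !split => //; lra.
have {y2} [y2 [y3 y4]] := y2.
have [yu yv] : gp y (rep u n) (rep z n) <= N /\ gp y (rep v n) (rep z n) <= N.
  have := gp_hyp hX y (rep u n) (rep z n) (rep v n); rewrite (gpC y (rep z n)).
  by rewrite /N; clear bM1 bM2 bM3 b1 b2 b3; case=> ?; split; lra.
have yuv : gp y (rep u n) (rep v n) <= N by rewrite /N; lra.
have yB : mdist o y <= B := tripod_dist hX bM1 bM2 bM3 yuv yu yv.
clear b1 b2 b3 bM1 bM2 bM3.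
have far w n0 : (n0 <= n)%N -> (forall i j, (n0 <= i)%N -> (n0 <= j)%N ->
      B + 2 * M + N + K + `|t| + 10 * delta < gp o (rep w i) (rep w j)) ->
    \forall m \near \oo, N + 2 * delta < gp y (rep w n) (rep w m).
  move=> n0n cw; exists n0 => // m /= n0m; have := cw n m n0n n0m.
  by have := gp_lip_base o y (rep w n) (rep w m); rewrite /M; lra.
have approx w w' : w <> w' -> gp y (rep w n) (rep w' n) <= N ->
    (\forall m \near \oo, N + 2 * delta < gp y (rep w n) (rep w m)) ->
    (\forall m \near \oo, N + 2 * delta < gp y (rep w' n) (rep w' m)) ->
    `|gpb y w w' - gp y (rep w n) (rep w' n)| <= 4 * delta.
  move=> ne ww' fw fw'; have [m [[mw mw'] g]] := filter_ex (filterI (filterI fw fw')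
    (gpb_near hX d0 y ne)).
  have := gp_replace2 hX d0 ww' mw mw'; move: g; clear -d0 => /=.
  by move=> /ler_normlP[? ?] /ler_normlP[? ?]; apply/ler_normlP; split; lra.
have [fu fv fz] := And3 (far _ _ ge1 c1) (far _ _ ge2 c2) (far _ _ ge3 c3).
have a1 := approx _ _ uv yuv fu fv; have a2 := approx _ _ uz yu fu fz.
have a3 := approx _ _ vz yv fv fz.
exists y; move: y1 y4 a1 a2 a3; clear -K0 d0.
move=> y1 /ler_normlP[? ?] /ler_normlP[? ?] /ler_normlP[? ?] /ler_normlP[? ?].
by split; [|apply/ler_normlP; split]; lra.
Qed.

(** * Cross ratios from translation lengths *)

Lemma ler_sum4 {R : realType} (x y z t : R) :
  0 <= x -> 0 <= y -> 0 <= z -> 0 <= t ->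
  [/\ x <= x + y + z + t, y <= x + y + z + t, z <= x + y + z + t &
      t <= x + y + z + t].
Proof. by move=> *; split; lra. Qed.

Definition cross_ratio {R : realType} {X : metricType R} (o : X)
    (alpha xi beta eta : boundary X) : R :=
  gpb o alpha beta + gpb o xi eta - gpb o alpha eta - gpb o xi beta.

Lemma cross_ratioN {R : realType} {X : metricType R} (o : X)
    (alpha xi beta eta : boundary X) :
  cross_ratio o alpha xi beta eta = - cross_ratio o xi alpha beta eta.
Proof. by rewrite /cross_ratio; lra. Qed.

Lemma cross_ratioD {R : realType} {X : metricType R} (o : X)
    (alpha xi zeta beta eta : boundary X) : cross_ratio o alpha xi beta eta =
  cross_ratio o alpha zeta beta eta - cross_ratio o xi zeta beta eta.
Proof. by rewrite /cross_ratio; lra. Qed.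

Lemma cross_ratioC {R : realType} {X : metricType R} (o : X)
    (alpha xi beta eta : boundary X) :
  cross_ratio o alpha xi beta eta = cross_ratio o beta eta alpha xi.
Proof.
rewrite /cross_ratio (gpbC o beta) (gpbC o beta) (gpbC o eta) (gpbC o eta).
by lra.
Qed.

Lemma cross_ratio_near {R : realType} {X : metricType R} (delta : R) (o : X)
    (alpha xi beta eta : boundary X) : hyperbolic delta X -> 0 <= delta ->
  alpha <> beta -> alpha <> eta -> xi <> beta -> xi <> eta ->
  \forall n \near \oo, `|cross_ratio o alpha xi beta eta -
    (gp o (rep alpha n) (rep beta n) + gp o (rep xi n) (rep eta n)
     - gp o (rep alpha n) (rep eta n) - gp o (rep xi n) (rep beta n))|
    <= 8 * delta.
Proof.
move=> hX d0 ab ae xb xe.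
apply: filterS (filterI (filterI (filterI (gpb_near hX d0 o ab)
  (gpb_near hX d0 o ae)) (gpb_near hX d0 o xb)) (gpb_near hX d0 o xe)).
move=> n [[[/= /ler_normlP[? ?] /ler_normlP[? ?]] /ler_normlP[? ?]] /ler_normlP[? ?]].
by apply/ler_normlP; rewrite /cross_ratio; split; lra.
Qed.

Lemma cross_ratio_lengths {R : realType} {G : groupType} {X : metricType R}
    (a : isometric_action G X) (delta M : R) (o : X) e x y alpha xi beta eta :
  hyperbolic delta X -> 0 <= delta -> 0 <= M ->
  alpha <> beta -> alpha <> eta -> xi <> beta -> xi <> eta ->
  (\forall n \near \oo, gp o (rep alpha n) (rep beta n) <= M) ->
  (\forall n \near \oo, gp o (rep alpha n) (rep eta n) <= M) ->
  (\forall n \near \oo, gp o (rep xi n) (rep beta n) <= M) ->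
  (\forall n \near \oo, gp o (rep xi n) (rep eta n) <= M) ->
  let r := 4 * M + 20 * delta in
  gp_above o r (rep beta) (cst (a e o)) -> gp_above o r (rep alpha) (cst (a e^-1%g o)) ->
  gp_above o r (rep beta) (cst (a x o)) -> gp_above o r (rep xi) (cst (a x^-1%g o)) ->
  gp_above o r (rep eta) (cst (a y o)) -> gp_above o r (rep alpha) (cst (a y^-1%g o)) ->
  `|(translation_length a o (e * x)%g + translation_length a o (e * y)%g
    - translation_length a o (e * (x * y))%g - translation_length a o e)
    - 2 * cross_ratio o alpha xi beta eta| <= 68 * delta.
Proof.
move=> hX d0 M0 ab ae xb xe h1 h2 h3 h4 r e1 e3 x1 x3 y1 y3.
have crX := cross_ratio_near o hX d0 ab ae xb xe.
have [n [[[[[[[[[[i1 i2] i3] i4] i5] i6] i7] i8] i9] i10] i11]] := filter_ex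
  (filterI (filterI (filterI (filterI (filterI (filterI (filterI (filterI
  (filterI (filterI crX e1) e3) x1) x3) y1) y3) h1) h2) h3) h4).
rewrite /= in i1 i2 i3 i4 i5 i6 i7 i8 i9 i10 i11.
rewrite gpC in i2; rewrite gpC in i3; rewrite gpC in i4; rewrite gpC in i5.
rewrite gpC in i6; rewrite gpC in i7.
have /ler_normlP[p1 p2] :=
  cross_ratio_of_lengths hX d0 M0 i3 i2 i5 i4 i7 i6 i8 i9 i10 i11.
case/ler_normlP: i1 => q1 q2; apply/ler_normlP; split; lra.
Qed.

Section TwoSpaces.
Context {R : realType} {G : groupType} {X Y : metricType R}.
Variables (a : isometric_action G X) (b : isometric_action G Y) (dX dY : R).
Hypotheses (hX : hyperbolic dX X) (dX0 : 0 <= dX).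
Hypotheses (hY : hyperbolic dY Y) (dY0 : 0 <= dY).
Variable F : boundary X -> boundary Y.
Hypotheses (F_inj : injective F) (F_cont : boundary_continuous F).
Hypothesis F_act : forall g xi, F (act_boundary a g xi) = act_boundary b g (F xi).

Let pair_transfer o' (r M : R) xi zeta1 zeta2 g : 0 <= M ->
  (\forall n \near \oo, gp o' (rep (F zeta1) n) (rep (F zeta2) n) <= M) ->
  gp_above o' (`|r| + 2 * M + 20 * dY + 1) (rep (F xi)) (rep (F (act_boundary a g zeta1))) ->
  gp_above o' (`|r| + 2 * M + 20 * dY + 1) (rep (F xi)) (rep (F (act_boundary a g zeta2))) ->
  gp_above o' r (rep (F xi)) (cst (b g o')).
Proof.
have d0 := dY0; move=> M0 hM; rewrite !F_act; set B := _ + 1 => h1 h2.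
have rB : r <= `|r| := ler_norm r.
have [//|bad] := gp_above_or hY dY0 o' r (b := boundary_pt (F xi))
  (c := interior_pt (b g o')) (rep_in _) erefl.
have r1 := rep_act_above b hY o' B g (F zeta1).
have r2 := rep_act_above b hY o' B g (F zeta2).
have [n [[[[[kM k1] k2] kb] kr1] kr2]] := filter_ex (filterI (filterI (filterI
  (filterI (filterI hM h1) h2) bad) r1) r2).
rewrite /= in kM k1 k2 kb kr1 kr2.
set w1 := rep (F zeta1) n in kM kr1; set w2 := rep (F zeta2) n in kM kr2.
set x := rep (F xi) n in k1 k2 kb.
have x1 : B - dY <= gp o' x (b g w1).
  by apply: (gp_trans hY (r := rep (act_boundary b g (F zeta1)) n)); lra.
have x2 : B - dY <= gp o' x (b g w2).
  by apply: (gp_trans hY (r := rep (act_boundary b g (F zeta2)) n)); lra.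
have x12 : B - 2 * dY <= gp o' (b g w1) (b g w2).
  by apply: (gp_trans hY (r := x)); rewrite 1?(gpC o' (b g w1)); lra.
have L := gp_lip_base (b g^-1%g o') o' w1 w2.
rewrite -gp_actV (metric_sym _ o') mdist_invg in L.
have e1 := gp_act_base b g o' w1; have e2 := gp_act_base b g o' w2.
suff : B - 2 * M - 4 * dY <= gp o' x (b g o') by rewrite /B; lra.
case: (gp_hyp hY o' w1 (b g^-1%g o') w2); rewrite ?(gpC o' w1 (b _ _)) => h.
  by apply: (gp_trans hY (r := b g w1)); rewrite 1?(gpC o' (b g w1)); lra.
by apply: (gp_trans hY (r := b g w2)); rewrite 1?(gpC o' (b g w2)); lra.
Qed.

(** If [g o] is close to [xi], then [g] maps at least two of three given boundary
    points close to [xi]. Continuity of [F] says the same in the other space, where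
    [g o'] is coarsely the center of the tripod spanned by the images of three
    points, and a center is close to [F xi] when two of the ends are. *)
Lemma orbit_transfer : three_points (boundary X) -> forall o o' xi r,
  exists r0, forall g, gp_above o r0 (rep xi) (cst (a g o)) ->
    gp_above o' r (rep (F xi)) (cst (b g o')).
Proof.
move=> [z1 [z2 [z3 [n12 n23 n13]]]] o o' xi r.
have [M12 M12_0 h12] := gpb_bounded hX dX0 o n12.
have [M23 M23_0 h23] := gpb_bounded hX dX0 o n23.
have [M13 M13_0 h13] := gpb_bounded hX dX0 o n13.
have Fne x y : x <> y -> F x <> F y by move=> ne /F_inj.
have [N12 N12_0 k12] := gpb_bounded hY dY0 o' (Fne _ _ n12).
have [N23 N23_0 k23] := gpb_bounded hY dY0 o' (Fne _ _ n23).
have [N13 N13_0 k13] := gpb_bounded hY dY0 o' (Fne _ _ n13).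
pose N := N12 + N23 + N13; have N0 : 0 <= N by rewrite !addr_ge0.
have [r1 hr1] := F_cont xi o o' (`|r| + 2 * N + 20 * dY + 1).
pose M := M12 + M23 + M13; exists (`|r1| + M + 10 * dX) => g hg.
have pair x y M' : 0 <= M' -> M' <= M ->
    (\forall n \near \oo, gp o (rep x n) (rep y n) <= M') ->
    gp_above o r1 (rep xi) (rep (act_boundary a g x)) \/
    gp_above o r1 (rep xi) (rep (act_boundary a g y)).
  move=> M'0 M'M hM'; apply: (orbit_pair_above hX dX0 M'0 hM').
  by apply: gp_above_le hg; lra.
have tr x y N' : N' <= N ->
    (\forall n \near \oo, gp o' (rep (F x) n) (rep (F y) n) <= N') ->
    gp_above o r1 (rep xi) (rep (act_boundary a g x)) ->
    gp_above o r1 (rep xi) (rep (act_boundary a g y)) ->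
    gp_above o' r (rep (F xi)) (cst (b g o')).
  move=> N'N hN' /hr1 hx /hr1 hy; apply: (pair_transfer N0 _ hx hy).
  by apply: filterS hN' => n; lra.
have p12 := pair _ _ _ M12_0 _ h12; have p23 := pair _ _ _ M23_0 _ h23.
have p13 := pair _ _ _ M13_0 _ h13.
have t12 := tr _ _ _ _ k12; have t23 := tr _ _ _ _ k23; have t13 := tr _ _ _ _ k13.
have [m12 m23 m13] : [/\ M12 <= M, M23 <= M & M13 <= M] by rewrite /M; split; lra.
have [l12 l23 l13] : [/\ N12 <= N, N23 <= N & N13 <= N] by rewrite /N; split; lra.
have [g1|g2] := p12 m12.
  have [g2|g3] := p23 m23; [exact: t12|exact: t13].
by have [g1|g3] := p13 m13; [exact: t12|exact: t23].
Qed.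

(** Elements with prescribed directions in both spaces exist by density, and their
    lengths agree. The error is uniform although the elements depend on the four
    points. *)
Lemma cross_ratio_transfer_dense (H : groupClosed G) h o o' k kp km :
  three_points (boundary X) -> dense_orbits a H -> k \in H ->
  power_limit a k o kp -> power_limit a k^-1%g o km ->
  (forall s s', s \in H -> s' \in H -> translation_length a o (s * h * s')%g =
     translation_length b o' (s * h * s')%g) ->
  forall alpha xi beta eta, alpha <> beta -> alpha <> eta -> xi <> beta -> xi <> eta ->
    `|cross_ratio o alpha xi beta eta -
      cross_ratio o' (F alpha) (F xi) (F beta) (F eta)| <= 34 * (dX + dY).
Proof.
have d0 := dX0; have d0' := dY0.
move=> three dense Hk kkp kkm lenE alpha xi beta eta ab ae xb xe.
have Fne x y : x <> y -> F x <> F y by move=> ne /F_inj.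
have [M1 M1_0 h1] := gpb_bounded hX dX0 o ab.
have [M2 M2_0 h2] := gpb_bounded hX dX0 o ae.
have [M3 M3_0 h3] := gpb_bounded hX dX0 o xb.
have [M4 M4_0 h4] := gpb_bounded hX dX0 o xe.
have [N1 N1_0 k1] := gpb_bounded hY dY0 o' (Fne _ _ ab).
have [N2 N2_0 k2] := gpb_bounded hY dY0 o' (Fne _ _ ae).
have [N3 N3_0 k3] := gpb_bounded hY dY0 o' (Fne _ _ xb).
have [N4 N4_0 k4] := gpb_bounded hY dY0 o' (Fne _ _ xe).
pose M := M1 + M2 + M3 + M4; pose N := N1 + N2 + N3 + N4.
pose rX := 4 * M + 20 * dX; pose rY := 4 * N + 20 * dY.
have deep z : exists r, forall g, gp_above o r (rep z) (cst (a g o)) ->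
    gp_above o rX (rep z) (cst (a g o)) /\ gp_above o' rY (rep (F z)) (cst (b g o')).
  have [r hr] := orbit_transfer three o o' z rY.
  by exists (Num.max rX r) => g hg; split;
    [|apply: hr]; apply: gp_above_le hg; rewrite le_max lexx ?orbT.
have ends u z w : exists s s', [/\ s \in H, s' \in H,
    gp_above o rX (rep z) (cst (a (s * u * s')%g o)) /\
    gp_above o' rY (rep (F z)) (cst (b (s * u * s')%g o')) &
    gp_above o rX (rep w) (cst (a (s * u * s')^-1%g o)) /\
    gp_above o' rY (rep (F w)) (cst (b (s * u * s')^-1%g o'))].
  have [r1 hr1] := deep z; have [r2 hr2] := deep w.
  have [s [s' [Hs Hs' e1 e2]]] :=
    double_coset_ends hX dX0 u dense Hk kkp kkm z w (Num.max r1 r2).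
  by exists s, s'; split => //; [apply: hr1; apply: gp_above_le e1|
    apply: hr2; apply: gp_above_le e2]; rewrite le_max lexx ?orbT.
have [s [s' [Hs Hs' [e1 e2] [e3 e4]]]] := ends h beta alpha.
have [t [t' [Ht Ht' [x1 x2] [x3 x4]]]] := ends 1%g beta xi.
have [u [u' [Hu Hu' [y1 y2] [y3 y4]]]] := ends 1%g eta alpha.
set e := (s * h * s')%g in e1 e2 e3 e4.
set x := (t * 1 * t')%g in x1 x2 x3 x4; set y := (u * 1 * u')%g in y1 y2 y3 y4.
have Hx : x \in H by rewrite /x mulg1 gpredM.
have Hy : y \in H by rewrite /y mulg1 gpredM.
have len z : z \in H -> translation_length a o (e * z)%g = translation_length b o' (e * z)%g.
  by move=> Hz; rewrite /e -mulgA lenE// gpredM.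
have l1 := len x Hx; have l2 := len y Hy.
have l3 := len (x * y)%g (gpredM _ _ Hx Hy); have := len 1%g gpred1.
rewrite mulg1 => l4.
have bnd (T : metricType R) (q : T) (z w : boundary T) (B B' : R) : B <= B' ->
    (\forall n \near \oo, gp q (rep z n) (rep w n) <= B) ->
    \forall n \near \oo, gp q (rep z n) (rep w n) <= B'.
  by move=> BB'; apply: filterS => n zw; exact: le_trans zw BB'.
have [m1 m2 m3 m4] : [/\ M1 <= M, M2 <= M, M3 <= M & M4 <= M].
  exact: ler_sum4.
have [n1 n2 n3 n4] : [/\ N1 <= N, N2 <= N, N3 <= N & N4 <= N].
  exact: ler_sum4.
have M0 : 0 <= M by rewrite !addr_ge0.
have N0 : 0 <= N by rewrite !addr_ge0.
have /ler_normlP[p1 p2] := cross_ratio_lengths hX d0 M0 ab ae xb xe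
  (bnd _ _ _ _ _ _ m1 h1)
  (bnd _ _ _ _ _ _ m2 h2)
  (bnd _ _ _ _ _ _ m3 h3)
  (bnd _ _ _ _ _ _ m4 h4) e1 e3 x1 x3 y1 y3.
have /ler_normlP[q1 q2] := cross_ratio_lengths hY d0' N0
  (Fne _ _ ab) (Fne _ _ ae) (Fne _ _ xb) (Fne _ _ xe)
  (bnd _ _ _ _ _ _ n1 k1)
  (bnd _ _ _ _ _ _ n2 k2)
  (bnd _ _ _ _ _ _ n3 k3)
  (bnd _ _ _ _ _ _ n4 k4) e2 e4 x2 x4 y2 y4.
rewrite -l1 -l2 -l3 -l4 in q1 q2.
by clear h1 h2 h3 h4 k1 k2 k3 k4 m1 m2 m3 m4 n1 n2 n3 n4; apply/ler_normlP; split; lra.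
Qed.

End TwoSpaces.

(** * Cross ratios when a boundary point is fixed *)

Lemma near_infty_bounded {R : realType} (u : nat -> R) (C : R) :
  (\forall n \near \oo, u n <= C) -> exists C', forall n, u n <= C'.
Proof.
move=> [N _ hN]; exists (`|C| + \sum_(i < N) `|u i|) => n.
have s0 : 0 <= \sum_(i < N) `|u i| by rewrite sumr_ge0.
case: (leqP N n) => nN.
  by have := hN n nN; have /= := ler_norm C; lra.
apply: (le_trans (ler_norm _)); rewrite (bigD1 (Ordinal nN)) //=.
have : 0 <= \sum_(i < N | i != Ordinal nN) `|u i| by rewrite sumr_ge0.
by have := normr_ge0 C; lra.
Qed.

Section Axis.
Context {R : realType} {G : groupType} {X : metricType R}.
Variables (a : isometric_action G X) (delta : R).
Hypotheses (hX : hyperbolic delta X) (delta0 : 0 <= delta).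
Implicit Types (g h k s u : G) (o p q : X) (x y : nat -> X).
Implicit Types (xi eta zeta omega z i : boundary X).

Lemma gpb_ge o xi eta : xi <> eta -> - (2 * delta) <= gpb o xi eta.
Proof.
move=> ne; have [n /= /ler_normlP[_ h]] := filter_ex (gpb_near hX delta0 o ne).
by have := gp_ge0 o (rep xi n) (rep eta n); lra.
Qed.

Lemma boundary_seqP o xi x : (forall r, \forall n \near \oo,
  gp_above o r (rep xi) (cst (x n))) -> (\val xi : set (nat -> X)) x.
Proof.
move=> h; apply/(boundary_relatedP hX)/gromov_relatedP => o' r.
have /gromov_relatedP/(_ o (r + mdist o o' + delta))[N hN] :=
  boundary_gromov (rep_in xi).
have [N' _ hN'] := h (r + mdist o o' + delta); exists (maxn N N') => i j.
rewrite !geq_max => /andP[i1 i2] /andP[j1 j2].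
have [m [/= m1 Nm]] := filter_ex (filterI (hN' j j2) (nbhs_infty_ge N)).
have := hN i m i1 Nm; have := gp_lip_base o o' (rep xi i) (x j).
by case: (gp_hyp hX o (rep xi i) (rep xi m) (x j)); lra.
Qed.

Lemma boundary_seq_above_self o r xi x : (\val xi : set (nat -> X)) x ->
  \forall n \near \oo, gp_above o r (rep xi) (cst (x n)).
Proof.
move=> xx; apply: (boundary_seq_above hX delta0 xx).
exact/gromov_related_gp_above/boundary_gromov/rep_in.
Qed.

Lemma boundary_seq_unbounded o (r : R) xi x : (\val xi : set (nat -> X)) x ->
  \forall n \near \oo, r < mdist o (x n).
Proof.
move=> /boundary_gromov/gromov_relatedP/(_ o r)[N hN]; exists N => // n Nn.
exact: lt_le_trans (hN n n Nn Nn) (gp_le _ _ _).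
Qed.

(** The finitely many terms for which [x n] is not yet close to [xi] are bounded by
    their distance to [o]; uniformity in [n] is what is used along an axis. *)
Lemma boundary_seq_avoid o xi eta x : xi <> eta -> (\val xi : set (nat -> X)) x ->
  exists B, forall n, \forall m \near \oo, gp o (rep eta m) (x n) <= B.
Proof.
move=> ne xx; have [M M0 hM] := gpb_bounded hX delta0 o ne.
have [N _ hN] := boundary_seq_above_self o (M + delta) xx.
exists (M + delta + \sum_(i < N) mdist o (x i)) => n.
have s0 : 0 <= \sum_(i < N) mdist o (x i) by rewrite sumr_ge0// => *; exact: mdist_ge0.
case: (leqP N n) => nN.
  apply: filterS (filterI hM (hN n nN)) => m [/= m1 m2].
  case: (gp_hyp hX o (rep xi m) (x n) (rep eta m)); last rewrite gpC; last by lra.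
  by rewrite (gpC o (rep eta m)); lra.
apply: nearW => m; rewrite gpC; apply: (le_trans (gp_le _ _ _)).
rewrite (bigD1 (Ordinal nN)) //=; have d0 := delta0.
have : 0 <= \sum_(i < N | i != Ordinal nN) mdist o (x i).
  by rewrite sumr_ge0// => *; exact: mdist_ge0.
by lra.
Qed.

Lemma gpb_bounds o xi eta : xi <> eta -> \forall n \near \oo,
  gp o (rep xi n) (rep eta n) <= gpb o xi eta + 2 * delta.
Proof.
move=> ne; apply: filterS (gpb_near hX delta0 o ne) => n /ler_normlP[_ h]; lra.
Qed.

Lemma gp_act_near o g xi eta : xi <> eta -> \forall n \near \oo,
  `|gp o (a g (rep xi n)) (a g (rep eta n))
    - gpb o (act_boundary a g xi) (act_boundary a g eta)| <= 4 * delta.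
Proof.
have d0 := delta0; move=> ne.
have ne' : act_boundary a g xi <> act_boundary a g eta.
  by move/(act_boundary_inj hX).
have B := gpb_bounds o ne'; set M := _ + 2 * delta in B.
apply: filterS (filterI (filterI (filterI B (gpb_near hX delta0 o ne'))
  (rep_act_above a hX o (M + 2 * delta) g xi))
  (rep_act_above a hX o (M + 2 * delta) g eta)) => n [[[/= h1 h2] h3] h4].
have /ler_normlP[? ?] := gp_replace2 hX delta0 h1 h3 h4.
by move: h2 => /ler_normlP[? ?]; apply/ler_normlP; split; lra.
Qed.

Lemma cross_ratio_act o g alpha xi beta eta :
  alpha <> beta -> alpha <> eta -> xi <> beta -> xi <> eta ->
  `|cross_ratio o (act_boundary a g alpha) (act_boundary a g xi)
      (act_boundary a g beta) (act_boundary a g eta)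
    - cross_ratio o alpha xi beta eta| <= 24 * delta.
Proof.
move=> ab ae xb xe; have [n [[[[h1 h2] h3] h4] h5]] := filter_ex
  (filterI (filterI (filterI (filterI (gp_act_near o g ab) (gp_act_near o g ae))
  (gp_act_near o g xb)) (gp_act_near o g xe))
  (cross_ratio_near o hX delta0 ab ae xb xe)).
rewrite /cross_ratio /= in h5 *; rewrite /= !gp_actV in h1 h2 h3 h4; set q := a g^-1%g o in h1 h2 h3 h4.
move: h1 h2 h3 h4 h5 => /ler_normlP[? ?] /ler_normlP[? ?] /ler_normlP[? ?]
  /ler_normlP[? ?] /ler_normlP[? ?].
have E : gp q (rep alpha n) (rep beta n) + gp q (rep xi n) (rep eta n)
     - gp q (rep alpha n) (rep eta n) - gp q (rep xi n) (rep beta n) =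
  gp o (rep alpha n) (rep beta n) + gp o (rep xi n) (rep eta n)
     - gp o (rep alpha n) (rep eta n) - gp o (rep xi n) (rep beta n).
  by rewrite /gp; lra.
by apply/ler_normlP; split; lra.
Qed.

(** The position of the projection of [zeta] to a line from [i] to [z], measured from
    [o] towards [z]. *)
Definition axis_coord o z i zeta : R := gpb o z zeta - gpb o i zeta.

(** With [p] the image of [o] by the inverse of [k^n], the difference is
    [(p|i)_o - (p|z)_o], in which the first term is the displacement and the second
    one is bounded because these points tend to [i]. *)
Lemma axis_coord_translate o k z i : power_limit a k o z ->
  power_limit a k^-1%g o i -> z <> i -> exists C, forall n zeta,
  zeta <> z -> zeta <> i ->
  `|axis_coord o z i (act_boundary a (k ^+ n)%g zeta) - axis_coord o z i zeta
    - mdist o (a (k ^+ n)%g o)| <= C.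
Proof.
have d0 := delta0; move=> kz ki zi.
have [B hB] := boundary_seq_avoid o zi kz.
have [B' hB'] := boundary_seq_avoid o (nesym zi) ki.
have kn n : commute k (k ^+ n)%g by exact/commuteX.
exists (`|B| + `|B'| + 20 * delta) => n zeta zz iz.
have fz := power_limit_fixed hX kz (kn n).
have fi : act_boundary a (k ^+ n)%g i = i.
  by apply: (power_limit_fixed hX ki); exact/commute_sym/commuteV/commute_sym.
have nz := gp_act_near o (k ^+ n)%g (nesym zz).
have ni := gp_act_near o (k ^+ n)%g (nesym iz).
rewrite fz in nz; rewrite fi in ni; set kzeta := act_boundary a _ zeta in nz ni *.
have nki := rep_act_above a hX o (`|B| + 2 * delta) (k ^+ n)%g i; rewrite fi in nki.
have [m [[[[[[h1 h2] h3] h4] h5] h6] h7]] := filter_ex (filterI (filterI (filterI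
  (filterI (filterI (filterI nz ni) (gpb_near hX d0 o (nesym zz)))
  (gpb_near hX d0 o (nesym iz))) (hB n)) (hB' n)) nki).
rewrite /= in h1 h2 h3 h4 h5 h6 h7.
rewrite expVgn in h6; rewrite !gp_actV in h1 h2.
set p := a (k ^+ n)^-1%g o in h1 h2 h6.
set w := rep zeta m in h1 h2 h3 h4; set zm := rep z m in h1 h3 h6.
set im := rep i m in h2 h4 h5 h7.
have op : mdist o p = mdist o (a (k ^+ n)%g o) by rewrite /p mdist_invg.
have b1 : gp o (a (k ^+ n)%g o) (a (k ^+ n)%g im) <= `|B| + delta.
  rewrite leNgt; apply/negP => h; have bB := ler_norm B.
  rewrite (gpC o im (a _ o)) in h5.
  case: (gp_hyp hX o (a (k ^+ n)%g o) (a (k ^+ n)%g im) im); first by lra.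
  by rewrite (gpC o _ im); lra.
have b2 := gp_act_base a (k ^+ n)%g o im; rewrite -/p in b2.
have b3 : gp o zm p <= `|B'| by have := ler_norm B'; lra.
have b4 := gp_ge0 o zm p; have b5 := gp_ge0 o (a (k ^+ n)%g o) (a (k ^+ n)%g im).
have E : (gp p zm w - gp p im w) - (gp o zm w - gp o im w) =
    gp o p im - gp o zm p by rewrite /gp; metric_lra.
move: h1 h2 h3 h4 => /ler_normlP[? ?] /ler_normlP[? ?] /ler_normlP[? ?]
  /ler_normlP[? ?].
have B0 := normr_ge0 B; have B0' := normr_ge0 B'.
by rewrite /axis_coord; apply/ler_normlP; split; lra.
Qed.

(** Since [h k^n] moves [o] towards [h z] and its inverse moves it towards [i],
    there is no cancellation in the limit. *)
Lemma translation_length_power h o k z i : power_limit a k o z ->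
  power_limit a k^-1%g o i -> act_boundary a h z <> i ->
  exists C, \forall n \near \oo,
    `|translation_length a o (h * k ^+ n)%g - mdist o (a (k ^+ n)%g o)| <= C.
Proof.
have d0 := delta0; move=> kz ki hzi.
have gz : (\val (act_boundary a h z) : set (nat -> X))
    (fun n => a (h * k ^+ n)%g o).
  have := act_boundary_in a h kz.
  by rewrite (_ : _ \o _ = fun n => a (h * k ^+ n)%g o) //; apply/funext => n;
    rewrite actM.
have gi : (\val i : set (nat -> X)) (fun n => a (h * k ^+ n)^-1%g o).
  apply: (boundary_bounded (C := mdist o (a h^-1%g o)) hX ki) => n /=.
  by rewrite expVgn invgM actM act_isometry.
have [rel|[M hM]] := related_or_bounded hX delta0 o (boundary_gromov gz)
    (boundary_gromov gi).
  case: hzi; apply: (boundary_eq hX gz); apply/(boundary_relatedP hX).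
  apply: (gromov_related_trans hX (boundary_related hX (rep_in _) gi)).
  exact: gromov_related_sym.
exists (2 * `|M| + mdist o (a h o) + 2 * delta).
apply: filterS (filterI hM (boundary_seq_unbounded o (2 * `|M| + 4 * delta) gz)).
move=> n [/= h1 h2]; have MM := ler_norm M.
have /(translation_length_axial hX d0)/ler_normlP[l1 l2] : axial a delta o (h * k ^+ n)%g.
  by rewrite /axial; lra.
have g0 := gp_ge0 o (a (h * k ^+ n)%g o) (a (h * k ^+ n)^-1%g o).
have t1 := metric_triangle o (a h o) (a (h * k ^+ n)%g o).
have t2 := metric_triangle (a h o) o (a (h * k ^+ n)%g o).
have E : mdist (a h o) (a (h * k ^+ n)%g o) = mdist o (a (k ^+ n)%g o).
  by rewrite actM act_isometry.
rewrite E (metric_sym (a h o) o) in t1 t2.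
by apply/ler_normlP; split; lra.
Qed.

Lemma gpb_replace o zeta omega : zeta <> omega -> exists r, forall eta,
  gp_above o r (rep zeta) (rep eta) ->
  eta <> omega /\ `|gpb o eta omega - gpb o zeta omega| <= 5 * delta.
Proof.
have d0 := delta0; move=> ne; exists (gpb o zeta omega + 3 * delta) => eta he.
have B := gpb_bounds o ne.
have ne' : eta <> omega.
  move=> e; rewrite e in he; have [n [/= h1 h2]] := filter_ex (filterI he B); lra.
split=> //; have [n [[[/= h1 h2] h3] h4]] := filter_ex (filterI (filterI (filterI he B)
  (gpb_near hX d0 o ne)) (gpb_near hX d0 o ne')).
have lt : gpb o zeta omega + 2 * delta + delta < gp o (rep zeta n) (rep eta n) by lra.
have /ler_normlP[? ?] := gp_replace hX h2 lt.
by move: h3 h4 => /ler_normlP[? ?] /ler_normlP[? ?]; apply/ler_normlP; split; lra.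
Qed.

End Axis.

Section AxisTransfer.
Context {R : realType} {G : groupType} {X Y : metricType R}.
Variables (a : isometric_action G X) (b : isometric_action G Y) (dX dY : R).
Hypotheses (hX : hyperbolic dX X) (dX0 : 0 <= dX).
Hypotheses (hY : hyperbolic dY Y) (dY0 : 0 <= dY).

(** Continuity at the attracting point compares the positions of [zeta] and of
    [F zeta] near this point; translating along the axis propagates this
    comparison to all positions, since the two translation lengths agree. *)
Lemma axis_coord_transfer (F : boundary X -> boundary Y) o o' k z i (C0 : R) :
  injective F -> boundary_continuous F ->
  (forall g xi, F (act_boundary a g xi) = act_boundary b g (F xi)) ->
  power_limit a k o z -> power_limit a k^-1%g o i -> z <> i ->
  power_limit b k o' (F z) -> power_limit b k^-1%g o' (F i) ->
  (forall n, `|mdist o (a (k ^+ n)%g o) - mdist o' (b (k ^+ n)%g o')| <= C0) ->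
  exists C, forall zeta, zeta <> z -> zeta <> i ->
    axis_coord o z i zeta - C <= axis_coord o' (F z) (F i) (F zeta).
Proof.
have d0 := dX0; have d0' := dY0.
move=> F_inj F_cont F_act kz ki zi kFz kFi LL.
have FzFi : F z <> F i by move/F_inj.
have [C1 hC1] := axis_coord_translate hX dX0 kz ki zi.
have [C2 hC2] := axis_coord_translate hY dY0 kFz kFi FzFi.
have [r0 hr0] := F_cont z o o' (gpb o' (F z) (F i) + 10 * dY).
pose s0 := `|r0| + 4 * dX + 1.
have near_z zeta : zeta <> z -> zeta <> i -> s0 <= axis_coord o z i zeta ->
    0 <= axis_coord o' (F z) (F i) (F zeta).
  move=> zz iz hs.
  have hz : gp_above o r0 (rep z) (rep zeta).
    apply: filterS (gpb_near hX dX0 o (nesym zz)) => n /ler_normlP[? ?].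
    have := gpb_ge hX dX0 o (nesym iz); have := ler_norm r0.
    by rewrite /axis_coord /s0 in hs *; lra.
  have Fzz : F z <> F zeta by move/F_inj/esym.
  have Fiz : F i <> F zeta by move/F_inj/esym.
  have [n [[[/= h1 h2] h3] h4]] := filter_ex (filterI (filterI (filterI (hr0 _ hz)
    (gpb_near hY d0' o' Fzz)) (gpb_near hY d0' o' Fiz)) (gpb_near hY d0' o' FzFi)).
  move: h2 h3 h4 => /ler_normlP[? ?] /ler_normlP[? ?] /ler_normlP[? ?].
  rewrite /axis_coord.
  by case: (gp_hyp hY o' (rep (F z) n) (rep (F zeta) n) (rep (F i) n));
    rewrite 1?(gpC o' (rep (F zeta) n)); lra.
pose L n := mdist o (a (k ^+ n)%g o).
have L0 : L 0%N = 0 by rewrite /L expg0 act1 mdistxx.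
have LS n : L n.+1 <= L n + L 1%N.
  rewrite /L expg1 expgSr actM.
  have := metric_triangle o (a (k ^+ n)%g o) (a (k ^+ n)%g (a k o)).
  by rewrite act_isometry.
(* The displacements [L n] form a coarsely dense subset of the half-line. *)
have steps t : 0 <= t -> exists n, L n <= t /\ t < L n.+1.
  move=> t0; have [N tN] := filter_ex (boundary_seq_unbounded o t kz).
  elim: N tN => [|N IH] tN; first by move: tN; rewrite -/(L 0%N) L0; lra.
  by have [LN|/IH//] := leP (L N) t; exists N.
have kn n : commute k (k ^+ n)%g by exact/commuteX.
have fz n : act_boundary a (k ^+ n)%g z = z by exact: (power_limit_fixed hX kz).
have fi n : act_boundary a (k ^+ n)%g i = i.
  by apply: (power_limit_fixed hX ki); exact/commute_sym/commuteV/commute_sym.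
have Fne zeta omega : zeta <> omega -> F zeta <> F omega by move=> ne /F_inj.
have c0 := normr_ge0 C0; have c1 := normr_ge0 C1; have c2 := normr_ge0 C2.
have n0 := ler_norm C0; have n1 := ler_norm C1; have n2 := ler_norm C2.
have L1 : 0 <= L 1%N := mdist_ge0 _ _.
exists (s0 + `|C0| + `|C1| + `|C2| + L 1%N) => zeta zz iz.
have [large|small] := leP (s0 + `|C1|) (axis_coord o z i zeta).
  have [n [Ln tn]] := steps (axis_coord o z i zeta - s0 - `|C1|) ltac:(lra).
  pose zeta' := act_boundary a (k ^+ n)^-1%g zeta.
  have kzeta' : act_boundary a (k ^+ n)%g zeta' = zeta by exact: act_boundaryK_inv.
  have zz' : zeta' <> z by move=> e; apply: zz; rewrite -kzeta' e fz.
  have iz' : zeta' <> i by move=> e; apply: iz; rewrite -kzeta' e fi.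
  have := hC1 n zeta' zz' iz'; have := hC2 n (F zeta') (Fne _ _ zz') (Fne _ _ iz').
  rewrite -F_act kzeta'; move: (LL n); rewrite -/(L n).
  move=> /ler_normlP[? ?] /ler_normlP[? ?] /ler_normlP[? ?].
  have := near_z zeta' zz' iz' ltac:(lra); have := LS n; lra.
have [n [Ln tn]] := steps (s0 + `|C1| - axis_coord o z i zeta) ltac:(lra).
pose zeta' := act_boundary a (k ^+ n.+1)%g zeta.
have zz' : zeta' <> z by rewrite -(fz n.+1) => /(act_boundary_inj hX).
have iz' : zeta' <> i by rewrite -(fi n.+1) => /(act_boundary_inj hX).
have := hC1 n.+1 zeta zz iz; have := hC2 n.+1 (F zeta) (Fne _ _ zz) (Fne _ _ iz).
rewrite -F_act -/zeta'; move: (LL n.+1); rewrite -/(L n.+1).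
move=> /ler_normlP[? ?] /ler_normlP[? ?] /ler_normlP[? ?].
have := near_z zeta' zz' iz' ltac:(lra); have := LS n; lra.
Qed.

End AxisTransfer.

Section FixedPoint.
Context {R : realType} {G : groupType} {X : metricType R}.
Variables (a : isometric_action G X) (delta : R) (H : groupClosed G).
Hypotheses (hX : hyperbolic delta X) (delta0 : 0 <= delta).
Hypothesis acc : forall xi, orbit_limit a [set` H] xi.
Implicit Types (g h k s u : G) (o p q : X).
Implicit Types (xi eta zeta omega z i : boundary X).

(** Otherwise the orbits of [k] and of its inverse would both stay away from [i],
    but the products of [i] with [k^n o] and with its inverse orbit point add up to
    the displacement. *)
Lemma fixed_is_limit o k kp km i : power_limit a k o kp ->
  power_limit a k^-1%g o km -> act_boundary a k i = i -> i = kp \/ i = km.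
Proof.
have d0 := delta0; move=> kkp kkm fi; apply: contrapT => /not_orP[ip im].
have [B hB] := boundary_seq_avoid hX delta0 o (nesym ip) kkp.
have [B' hB'] := boundary_seq_avoid hX delta0 o (nesym im) kkm.
have [n Ln] := filter_ex (boundary_seq_unbounded o (`|B| + `|B'| + delta) kkp).
have fin : act_boundary a (k ^+ n)%g i = i.
  elim: n {Ln} => [|n IH]; first by rewrite expg0 (act_boundary1 a hX).
  by rewrite expgS (act_boundaryM a hX) IH.
have := rep_act_above a hX o (`|B| + delta) (k ^+ n)%g i; rewrite fin => ri.
have [m [[/= h1 h2] h3]] := filter_ex (filterI (filterI ri (hB n)) (hB' n)).
rewrite expVgn in h3.
have e := gp_act_base a (k ^+ n)%g o (rep i m); rewrite gpC in e.
have := ler_norm B; have := ler_norm B'; rewrite (gpC o (rep i m)) in h3.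
by case: (gp_hyp hX o (rep i m) (a (k ^+ n)%g (rep i m)) (a (k ^+ n)%g o)); lra.
Qed.

Lemma dense_fixed_orbit i z : (forall s, s \in H -> act_boundary a s i = i) ->
  z <> i -> forall o r w, w <> i ->
  exists2 s, s \in H & gp_above o r (rep w) (rep (act_boundary a s z)).
Proof.
move=> fi zi o r w wi; have [M M0 hM] := gpb_bounded hX delta0 o wi.
have [s Hs [hs|hs]] := orbit_limit_pair hX delta0 (acc w) zi o (Num.max r M).
  by exists s => //; apply: gp_above_le hs; rewrite le_max lexx.
rewrite fi // in hs; have [n [/= h1 h2]] := filter_ex (filterI hs hM).
by move: h1; rewrite gt_max => /andP[_]; lra.
Qed.

(** The fixed point is an end of the axis of any axial element of [H]. If [h] maps
    the other end [z] to [i], a conjugate of this element by some [s] in [H] moving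
    [z] has another end, which [h] cannot map to [i]. *)
Lemma fixed_point_axis o h i : three_points (boundary X) ->
  (forall s, s \in H -> act_boundary a s i = i) ->
  exists k z, [/\ k \in H, power_limit a k o z, power_limit a k^-1%g o i, z <> i &
    act_boundary a h z <> i].
Proof.
move=> [x1 [x2 [x3 [n12 n23 n13]]]] fi.
have [k0 Hk0 ax] : exists2 k, k \in H & axial a delta o k.
  by apply: (exists_axial hX delta0) => //; exists x1, x2.
have [k [z [Hk kz ki zi]]] : exists k z, [/\ k \in H, power_limit a k o z,
    power_limit a k^-1%g o i & z <> i].
  have [kp [km [kkp kkm ne]]] := axial_limits hX delta0 ax.
  have [e|e] := fixed_is_limit kkp kkm (fi _ Hk0).
    exists k0^-1%g, km; rewrite gpredV invgK e; split => //; exact/nesym.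
  by exists k0, kp; rewrite e.
have [hz|hz] := pselect (act_boundary a h z = i); last by exists k, z.
have [w [wz wi]] : exists w, w <> z /\ w <> i.
  have [e1|?] := pselect (x1 = z); have [e2|?] := pselect (x1 = i);
  have [e3|?] := pselect (x2 = z); have [e4|?] := pselect (x2 = i);
  by [exists x1; split|exists x2; split|exists x3; split; congruence].
have [M _ hM] := gpb_bounded hX delta0 o wz.
have [s Hs hs] := dense_fixed_orbit fi zi o M wi.
have sz : act_boundary a s z <> z.
  move=> e; rewrite e in hs.
  by have [n [/= h1 h2]] := filter_ex (filterI hs hM); rewrite ltNge h2 in h1.
have conj_limit l xi : power_limit a l o xi ->
    power_limit a (s * l * s^-1)%g o (act_boundary a s xi).
  move=> lxi; apply: (boundary_bounded (C := mdist o (a s^-1%g o)) hX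
    (act_boundary_in a s lxi)) => n /=.
  have -> : ((s * l * s^-1) ^+ n)%g = (s * (l ^+ n * s^-1))%g.
    elim: n => [|n IH]; first by rewrite !expg0 mul1g mulgV.
    by rewrite !expgS IH !mulgA mulgVK.
  by rewrite !actM !act_isometry.
exists (s * k * s^-1)%g, (act_boundary a s z); split.
- by rewrite !gpredM ?gpredV.
- exact: conj_limit.
- by rewrite -(fi s Hs) !invgM invgK mulgA; exact: conj_limit.
- by rewrite -(fi s Hs) => /(act_boundary_inj hX).
- by rewrite -hz => /(act_boundary_inj hX).
Qed.

End FixedPoint.

Section CrossRatioTransfer.
Context {R : realType} {G : groupType} {X Y : metricType R}.
Variables (a : isometric_action G X) (b : isometric_action G Y) (dX dY : R).
Hypotheses (hX : hyperbolic dX X) (dX0 : 0 <= dX).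
Hypotheses (hY : hyperbolic dY Y) (dY0 : 0 <= dY).
Variables (F : boundary X -> boundary Y) (F' : boundary Y -> boundary X).
Hypotheses (FK : cancel F F') (F'K : cancel F' F).
Hypotheses (F_cont : boundary_continuous F) (F'_cont : boundary_continuous F').
Hypothesis F_act : forall g xi, F (act_boundary a g xi) = act_boundary b g (F xi).
Variables (H : groupClosed G) (h : G) (o : X) (o' : Y).
Hypothesis three : three_points (boundary X).
Hypothesis acc : forall xi, orbit_limit a [set` H] xi.
Hypothesis lenE : forall s s', s \in H -> s' \in H ->
  translation_length a o (s * h * s')%g = translation_length b o' (s * h * s')%g.

Let F_inj : injective F := can_inj FK.
Let Fne x y : x <> y -> F x <> F y. Proof. by move=> ne /F_inj. Qed.

Let F'_act g eta : F' (act_boundary b g eta) = act_boundary a g (F' eta).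
Proof. by rewrite -{1}(F'K eta) -F_act FK. Qed.

Lemma power_limit_transfer k xi : power_limit a k o xi -> power_limit b k o' (F xi).
Proof.
move=> kxi; apply: (boundary_seqP hY (o := o')) => r.
have [r0 hr0] := orbit_transfer hX dX0 hY dY0 F_inj F_cont F_act three o o' xi r.
by apply: filterS (boundary_seq_above_self hX dX0 o r0 kxi) => n; exact: hr0.
Qed.

Lemma displacement_transfer k z i : k \in H -> power_limit a k o z ->
  power_limit a k^-1%g o i -> act_boundary a h z <> i -> exists C, forall n,
  `|mdist o (a (k ^+ n)%g o) - mdist o' (b (k ^+ n)%g o')| <= C.
Proof.
move=> Hk kz ki hzi; have [C hC] := translation_length_power hX dX0 kz ki hzi.
have hFz : act_boundary b h (F z) <> F i by rewrite -F_act; exact: Fne.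
have [C' hC'] := translation_length_power hY dY0 (power_limit_transfer kz)
  (power_limit_transfer ki) hFz.
apply: (@near_infty_bounded _ _ (C + C')).
apply: filterS (filterI hC hC') => n [/= h1 h2].
have e := lenE (gpred1 : 1%g \in H) (gpredXn n Hk); rewrite mul1g in e.
rewrite e in h1; move: h1 h2 => /ler_normlP[? ?] /ler_normlP[? ?].
by apply/ler_normlP; split; lra.
Qed.

(** The comparison along one axis ending at [i] holds with the same constant along
    its translates by [H], whose other ends are dense, hence along all lines ending
    at [i]. The identity [cr x z = cr x i - cr z i] in the first two arguments of the
    cross ratio concludes when [i] is not among the last two, and the symmetry
    between the two pairs of arguments otherwise. *)
Lemma cross_ratio_transfer_fixed i :
  (forall s, s \in H -> act_boundary a s i = i) ->
  exists C, forall alpha xi beta eta,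
    alpha <> beta -> alpha <> eta -> xi <> beta -> xi <> eta ->
    `|cross_ratio o alpha xi beta eta -
      cross_ratio o' (F alpha) (F xi) (F beta) (F eta)| <= C.
Proof.
have d0 := dX0; have d0' := dY0; move=> fi.
have [k [z [Hk kz ki zi hzi]]] := fixed_point_axis hX dX0 acc o h three fi.
have [kFz kFi] := (power_limit_transfer kz, power_limit_transfer ki).
have [C0 hC0] := displacement_transfer Hk kz ki hzi.
have [C1 hC1] := axis_coord_transfer hX dX0 hY dY0 F_inj F_cont F_act kz ki zi
  kFz kFi hC0.
have hC0' n : `|mdist o' (b (k ^+ n)%g o') - mdist o (a (k ^+ n)%g o)| <= C0.
  by rewrite distrC.
have [C2 hC2] : exists C, forall eta, eta <> F z -> eta <> F i ->
    axis_coord o' (F z) (F i) eta - C <= axis_coord o (F' (F z)) (F' (F i)) (F' eta).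
  apply: (axis_coord_transfer hY dY0 hX dX0 (can_inj F'K) F'_cont F'_act kFz kFi
    (Fne zi) _ _ hC0'); rewrite FK //.
rewrite !FK in hC2.
pose C3 := `|C1| + `|C2|.
have axisC zeta : zeta <> z -> zeta <> i ->
    `|axis_coord o z i zeta - axis_coord o' (F z) (F i) (F zeta)| <= C3.
  move=> zz iz; have := hC2 (F zeta) (Fne zz) (Fne iz); rewrite FK.
  have := hC1 zeta zz iz; have := ler_norm C1; have := ler_norm C2.
  have := normr_ge0 C1; have := normr_ge0 C2.
  by rewrite /C3 => *; apply/ler_normlP; split; lra.
have axis0 zeta omega : zeta <> z -> zeta <> i -> omega <> z -> omega <> i ->
    `|cross_ratio o z i zeta omega -
      cross_ratio o' (F z) (F i) (F zeta) (F omega)| <= 2 * C3.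
  rewrite /axis_coord in axisC.
  move=> zz iz zo io; have /ler_normlP[? ?] := axisC _ zz iz.
  have /ler_normlP[? ?] := axisC _ zo io.
  by rewrite /cross_ratio; apply/ler_normlP; split; lra.
pose C4 := 2 * C3 + 24 * (dX + dY).
have axisS s zeta omega : s \in H -> zeta <> act_boundary a s z -> zeta <> i ->
    omega <> act_boundary a s z -> omega <> i ->
    `|cross_ratio o (act_boundary a s z) i zeta omega -
      cross_ratio o' (F (act_boundary a s z)) (F i) (F zeta) (F omega)| <= C4.
  move=> Hs; rewrite -(fi s Hs).
  rewrite -(act_boundaryK_inv a hX s zeta) -(act_boundaryK_inv a hX s omega).
  set zeta' := act_boundary a _ zeta; set omega' := act_boundary a _ omega.
  clearbody zeta' omega'.
  move=> zz iz zo io.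
  have ne x y : act_boundary a s x <> act_boundary a s y -> x <> y.
    by move=> + e; rewrite e.
  have {}zz := ne _ _ zz; have {}iz := ne _ _ iz.
  have {}zo := ne _ _ zo; have {}io := ne _ _ io.
  have /ler_normlP[? ?] := axis0 _ _ zz iz zo io.
  have /ler_normlP[? ?] := cross_ratio_act a hX dX0 o s (nesym zz) (nesym zo)
    (nesym iz) (nesym io).
  have /ler_normlP[? ?] := cross_ratio_act b hY dY0 o' s (Fne (nesym zz))
    (Fne (nesym zo)) (Fne (nesym iz)) (Fne (nesym io)).
  by rewrite !F_act /C4; apply/ler_normlP; split; lra.
pose C5 := C4 + 10 * (dX + dY).
have axisW w zeta omega : w <> i -> zeta <> w -> zeta <> i -> omega <> w ->
    omega <> i -> `|cross_ratio o w i zeta omega -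
      cross_ratio o' (F w) (F i) (F zeta) (F omega)| <= C5.
  rewrite /cross_ratio in axisS *; move=> wi zw iz ow io.
  have [r1 hr1] := gpb_replace hX dX0 o (nesym zw).
  have [r2 hr2] := gpb_replace hX dX0 o (nesym ow).
  have [r3 hr3] := gpb_replace hY dY0 o' (Fne (nesym zw)).
  have [r4 hr4] := gpb_replace hY dY0 o' (Fne (nesym ow)).
  have [r5 hr5] := F_cont w o o' r3; have [r6 hr6] := F_cont w o o' r4.
  have [s Hs hs] := dense_fixed_orbit hX dX0 acc fi zi o
    (Num.max r1 (Num.max r2 (Num.max r5 r6))) wi.
  have [s1 s2 s5 s6] : [/\ gp_above o r1 (rep w) (rep (act_boundary a s z)),
      gp_above o r2 (rep w) (rep (act_boundary a s z)),
      gp_above o r5 (rep w) (rep (act_boundary a s z)) &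
      gp_above o r6 (rep w) (rep (act_boundary a s z))].
    by split; apply: gp_above_le hs; rewrite !le_max lexx ?orbT.
  have [zs /ler_normlP[? ?]] := hr1 _ s1; have [os /ler_normlP[? ?]] := hr2 _ s2.
  have [_ /ler_normlP[? ?]] := hr3 _ (hr5 _ s5).
  have [_ /ler_normlP[? ?]] := hr4 _ (hr6 _ s6).
  have /ler_normlP[? ?] := axisS s zeta omega Hs (nesym zs) iz (nesym os) io.
  by rewrite /C5; apply/ler_normlP; split; lra.
have C5_0 : 0 <= C5.
  have := axisW; rewrite /C5 /C4 /C3 => _.
  by have := normr_ge0 C1; have := normr_ge0 C2; lra.
exists (2 * C5) => alpha xi beta eta ab ae xb xe.
have ei x y : cross_ratio o i i x y = 0 by rewrite /cross_ratio; lra.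
have eFi x y : cross_ratio o' (F i) (F i) x y = 0 by rewrite /cross_ratio; lra.
have axisW' w zeta omega : zeta <> w -> zeta <> i -> omega <> w ->
    omega <> i -> `|cross_ratio o w i zeta omega -
      cross_ratio o' (F w) (F i) (F zeta) (F omega)| <= C5.
  have [->|wi] := pselect (w = i); last exact: axisW.
  by rewrite ei eFi subrr normr0.
have le2 t : t <= C5 -> t <= 2 * C5 by lra.
have [bi|bi] := pselect (beta = i).
  rewrite bi in ab xb *; rewrite (cross_ratioC o) (cross_ratioC o').
  rewrite (cross_ratioN o) (cross_ratioN o') -opprD normrN.
  exact/le2/axisW'.
have [ei'|nei] := pselect (eta = i).
  rewrite ei' in ae xe *; rewrite (cross_ratioC o) (cross_ratioC o').
  exact/le2/axisW'.
rewrite (cross_ratioD o alpha xi i) (cross_ratioD o' (F alpha) (F xi) (F i)).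
have := axisW' alpha beta eta (nesym ab) bi (nesym ae) nei.
have := axisW' xi beta eta (nesym xb) bi (nesym xe) nei.
clear le2 axisW' axisW axisS axis0 axisC ei eFi hC0' hC0 hC1 hC2 ab ae xb xe.
by move=> /ler_normlP[? ?] /ler_normlP[? ?]; apply/ler_normlP; split; lra.
Qed.

End CrossRatioTransfer.

(** * Extension of the boundary map to the spaces *)

Lemma dense_orbits_or_fixed {R : realType} {G : groupType} {X : metricType R}
    (a : isometric_action G X) (delta : R) (H : groupClosed G) :
  hyperbolic delta X -> 0 <= delta -> (forall xi, orbit_limit a [set` H] xi) ->
  dense_orbits a H \/ exists i, forall s, s \in H -> act_boundary a s i = i.
Proof.
move=> hX d0 acc.
have [|nfix] := pselect (exists i, forall s, s \in H -> act_boundary a s i = i).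
  by right.
left=> tau xi o r; have [s Hs st] : exists2 s, s \in H & act_boundary a s tau <> tau.
  apply: contrapT => h; apply: nfix; exists tau => s Hs.
  by apply: contrapT => st; apply: h; exists s.
have [k Hk [kr|kr]] := orbit_limit_pair hX d0 (acc xi) st o r.
  by exists (k * s)%g; [exact: gpredM|rewrite (act_boundaryM a hX)].
by exists k.
Qed.

Lemma third_point (T : Type) (x y : T) : three_points T -> exists z, x <> z /\ y <> z.
Proof.
move=> [x1 [x2 [x3 [n12 n23 n13]]]].
have [e1|?] := pselect (x = x1); have [e2|?] := pselect (y = x1);
have [e3|?] := pselect (x = x2); have [e4|?] := pselect (y = x2);
by [exists x1; split|exists x2; split|exists x3; split; congruence].
Qed.

Section GromovProductBoundary.
Context {R : realType} {X : metricType R}.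
Variable delta : R.
Hypotheses (hX : hyperbolic delta X) (delta0 : 0 <= delta).

Lemma cross_ratio_base (o p : X) alpha xi beta eta :
  alpha <> beta -> alpha <> eta -> xi <> beta -> xi <> eta ->
  `|cross_ratio p alpha xi beta eta - cross_ratio o alpha xi beta eta| <= 16 * delta.
Proof.
move=> ab ae xb xe.
have [n [/= /ler_normlP[h1 h2] /ler_normlP[h3 h4]]] := filter_ex (filterI
  (cross_ratio_near o hX delta0 ab ae xb xe) (cross_ratio_near p hX delta0 ab ae xb xe)).
by apply/ler_normlP; rewrite /gp in h1 h2 h3 h4; split; lra.
Qed.

Lemma gpb_hyp (o : X) xi eta zeta : xi <> eta -> xi <> zeta -> eta <> zeta ->
  gpb o xi zeta - 5 * delta <= gpb o xi eta \/
  gpb o eta zeta - 5 * delta <= gpb o xi eta.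
Proof.
move=> xe xz ez.
have [n [[/= /ler_normlP[? ?] /ler_normlP[? ?]] /ler_normlP[? ?]]] := filter_ex
  (filterI (filterI (gpb_near hX delta0 o xe) (gpb_near hX delta0 o xz))
  (gpb_near hX delta0 o ez)).
by case: (gp_hyp hX o (rep xi n) (rep zeta n) (rep eta n));
  rewrite ?(gpC o (rep zeta n)) => ?; [left|right]; lra.
Qed.

End GromovProductBoundary.

(** Compatible points see the boundary in the same way. Compatibility determines
    each of them in terms of the other up to a bounded distance. *)
Definition compatible {R : realType} {X Y : metricType R}
    (F : boundary X -> boundary Y) (C : R) (p : X) (y : Y) :=
  forall alpha beta, alpha <> beta ->
    `|gpb p alpha beta - gpb y (F alpha) (F beta)| <= C.

Section Extension.
Context {R : realType} {X Y : metricType R}.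
Variables (dX dY CV : R).
Hypotheses (hX : hyperbolic dX X) (dX0 : 0 <= dX).
Hypotheses (hY : hyperbolic dY Y) (dY0 : 0 <= dY).
Variable F : boundary X -> boundary Y.
Hypotheses (F_inj : injective F) (three : three_points (boundary X)).
Hypothesis visible : forall p : X, exists xi eta, xi <> eta /\
  \forall n \near \oo, gp p (rep xi n) (rep eta n) <= CV.

Let Fne x y : x <> y -> F x <> F y. Proof. by move=> ne /F_inj. Qed.

(** A difference of distances to a point at infinity is a combination of Gromov
    products of boundary points. *)
Lemma compatible_busemann (C : R) p q y y' u v z : u <> v -> u <> z -> v <> z ->
  compatible F C p y -> compatible F C q y' ->
  \forall n \near \oo, mdist (rep u n) p - mdist (rep u n) q <=
    mdist y y' + 6 * C + 12 * dX + 12 * dY.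
Proof.
move=> uv uz vz py qy.
have ineq (T : metricType R) (d : R) (o : T) : hyperbolic d T -> 0 <= d ->
    forall u' v' z' : boundary T, u' <> v' -> u' <> z' -> v' <> z' ->
    \forall n \near \oo, `|(gp o (rep u' n) (rep v' n) + gp o (rep u' n) (rep z' n)
      - gp o (rep v' n) (rep z' n)) - (gpb o u' v' + gpb o u' z' - gpb o v' z')| <= 6 * d.
  move=> hT d0 u' v' z' uv' uz' vz'.
  apply: filterS (filterI (filterI (gpb_near hT d0 o uv') (gpb_near hT d0 o uz'))
    (gpb_near hT d0 o vz')) => n [[/= /ler_normlP[? ?] /ler_normlP[? ?]] /ler_normlP[? ?]].
  by apply/ler_normlP; split; lra.
have compat p' y0 : compatible F C p' y0 ->
    `|(gpb p' u v + gpb p' u z - gpb p' v z)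
      - (gpb y0 (F u) (F v) + gpb y0 (F u) (F z) - gpb y0 (F v) (F z))| <= 3 * C.
  move=> h; move: (h _ _ uv) (h _ _ uz) (h _ _ vz).
  by move=> /ler_normlP[? ?] /ler_normlP[? ?] /ler_normlP[? ?]; apply/ler_normlP; split; lra.
apply: filterS (filterI (filterI (ineq _ _ p hX dX0 _ _ _ uv uz vz)
  (ineq _ _ q hX dX0 _ _ _ uv uz vz)) (filterI
  (ineq _ _ y hY dY0 _ _ _ (Fne uv) (Fne uz) (Fne vz))
  (ineq _ _ y' hY dY0 _ _ _ (Fne uv) (Fne uz) (Fne vz)))) => n.
have bus (T : metricType R) (o o' x x' x'' : T) : mdist x o - mdist x o' =
    (gp o x x' + gp o x x'' - gp o x' x'') - (gp o' x x' + gp o' x x'' - gp o' x' x'').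
  by rewrite /gp; lra.
have tri := metric_triangle (rep (F u) n) y' y; rewrite (metric_sym y' y) in tri.
move: (compat _ _ py) (compat _ _ qy) => /ler_normlP[? ?] /ler_normlP[? ?] /=.
rewrite (bus _ p q _ (rep v n) (rep z n)).
have := bus _ y y' (rep (F u) n) (rep (F v) n) (rep (F z) n).
move=> ? [[/ler_normlP[? ?] /ler_normlP[? ?]] [/ler_normlP[? ?] /ler_normlP[? ?]]].
lra.
Qed.

(** One of two boundary points seen from [q] in opposite directions is also
    opposite to [p], so that the distance from [p] to [q] is coarsely a difference
    of distances to this point. *)
Lemma compatible_dist (C : R) p q y y' : compatible F C p y -> compatible F C q y' ->
  mdist p q <= mdist y y' + (2 * CV + 6 * C + 14 * dX + 12 * dY).
Proof.
move=> py qy; have [u [v [uv huv]]] := visible q.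
have [z [uz vz]] := third_point u v three.
have [n [[/= h0 hu] hv]] := filter_ex (filterI (filterI huv
  (compatible_busemann uv uz vz py qy)) (compatible_busemann (nesym uv) vz uz py qy)).
have eu : mdist (rep u n) p - mdist (rep u n) q = mdist p q - 2 * gp q (rep u n) p.
  by rewrite /gp; metric_lra.
have ev : mdist (rep v n) p - mdist (rep v n) q = mdist p q - 2 * gp q p (rep v n).
  by rewrite /gp; metric_lra.
by have d0' := dY0; case: (gp_hyp hX q (rep u n) p (rep v n)); lra.
Qed.

End Extension.

(** A pair of nearly nonnegative numbers whose minimum is small is determined by its
    difference. *)
Lemma difference_determines {R : realType} (x x' y y' m m' c c' e : R) :
  0 <= m -> 0 <= m' -> 0 <= c -> 0 <= c' -> - c <= x -> - c <= x' -> - c' <= y -> - c' <= y' ->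
  x <= m \/ x' <= m -> y <= m' \/ y' <= m' -> `|(x - x') - (y - y')| <= e ->
  `|x - y| <= m + m' + e + c + c' /\ `|x' - y'| <= m + m' + e + c + c'.
Proof.
move=> m0 m'0 c0 c'0 h1 h2 h3 h4 hx hy h; have := le_trans (normr_ge0 _) h.
move: h => /ler_normlP[h5 h6] e0.
by split; apply/ler_normlP; case: hx => ?; case: hy => ?; split; lra.
Qed.

(** The point [y] is placed on a line between the images of two boundary points
    seen from [p] in opposite directions, at the position prescribed by a third
    one. As for any fourth point at least one of the two Gromov products with
    them is small, cross ratios determine both. *)
Lemma exists_compatible {R : realType} {X Y : metricType R} (dX dY CV K C0 : R)
    (F : boundary X -> boundary Y) (o : X) (o' : Y) :
  hyperbolic dX X -> 0 <= dX -> hyperbolic dY Y -> 0 <= dY ->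
  injective F -> three_points (boundary X) ->
  (forall p : X, exists xi eta, xi <> eta /\
    \forall n \near \oo, gp p (rep xi n) (rep eta n) <= CV) ->
  0 < K -> roughly_geodesic K Y ->
  (forall alpha xi beta eta,
    alpha <> beta -> alpha <> eta -> xi <> beta -> xi <> eta ->
    `|cross_ratio o alpha xi beta eta -
      cross_ratio o' (F alpha) (F xi) (F beta) (F eta)| <= C0) ->
  exists C, forall p, exists y, compatible F C p y.
Proof.
move=> hX d0 hY d0' F_inj three visible K0 geod cr.
have Fne x y : x <> y -> F x <> F y by move=> ne /F_inj.
pose C1 := C0 + 16 * (dX + dY); pose e := C1 + K + 8 * dY.
pose mX := CV + 7 * dX; pose mY := 2 * K + 9 * dY.
pose C2 := mX + mY + e + 2 * (dX + dY).
pose C := C1 + (mX + mY + 2 * (dX + dY)) + 2 * C2.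
exists C => p.
have [xi [eta [xe vis]]] := visible p.
have [zeta [xz ez]] := third_point xi eta three.
have [y [yxe yt]] := point_on_line (gpb p xi zeta - gpb p eta zeta) o' hY d0' K0
  geod (Fne _ _ xe) (Fne _ _ xz) (Fne _ _ ez).
exists y; move: yt => /ler_normlP[yt1 yt2].
have gxe : gpb p xi eta <= CV + 2 * dX.
  have [n [/= h1 /ler_normlP[? ?]]] := filter_ex (filterI vis (gpb_near hX d0 p xe)).
  by lra.
have gxe0 := gpb_ge hX d0 p xe; have yxe0 := gpb_ge hY d0' y (Fne _ _ xe).
have crpy alpha xi' beta eta' : alpha <> beta -> alpha <> eta' -> xi' <> beta ->
    xi' <> eta' -> `|cross_ratio p alpha xi' beta eta' -
      cross_ratio y (F alpha) (F xi') (F beta) (F eta')| <= C1.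
  move=> ab ae xb xe'; have /ler_normlP[? ?] := cr _ _ _ _ ab ae xb xe'.
  have /ler_normlP[? ?] := cross_ratio_base hX d0 o p ab ae xb xe'.
  have /ler_normlP[? ?] := cross_ratio_base hY d0' o' y (Fne _ _ ab) (Fne _ _ ae)
    (Fne _ _ xb) (Fne _ _ xe').
  by rewrite /C1; apply/ler_normlP; split; lra.
rewrite /cross_ratio in crpy.
have C1_0 : 0 <= C1.
  by apply: le_trans (crpy _ _ _ _ xz xz ez ez); exact: normr_ge0.
have step alpha : xi <> alpha -> eta <> alpha ->
    `|gpb p xi alpha - gpb y (F xi) (F alpha)| <= C2 /\
    `|gpb p eta alpha - gpb y (F eta) (F alpha)| <= C2.
  move=> xa ea.
  have -> : C2 = mX + mY + e + 2 * dX + 2 * dY by rewrite /C2; lra.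
  apply: difference_determines; [by rewrite /mX; lra|by rewrite /mY; lra|
    by lra|by lra|exact: gpb_ge|exact: gpb_ge|
    exact/gpb_ge/Fne|exact/gpb_ge/Fne| | |].
  - by have := gpb_hyp hX d0 p xe xa ea; rewrite /mX => -[?|?]; [left|right]; lra.
  - have := gpb_hyp hY d0' y (Fne _ _ xe) (Fne _ _ xa) (Fne _ _ ea).
    by rewrite /mY => -[?|?]; [left|right]; lra.
  - have /ler_normlP[? ?] := crpy _ _ _ _ xz xa ez ea.
    by rewrite /e; apply/ler_normlP; split; lra.
have C2_0 : 0 <= C2 by have [h _] := step _ xz ez; exact: le_trans h.
have small : `|gpb p xi eta - gpb y (F xi) (F eta)| <= mX + mY + 2 * (dX + dY).
  by rewrite /mX /mY; apply/ler_normlP; split; lra.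
have small0 : 0 <= mX + mY + 2 * (dX + dY) by exact: le_trans small.
have xiC beta : xi <> beta -> `|gpb p xi beta - gpb y (F xi) (F beta)| <= C.
  move=> xb; have [<-|eb] := pselect (eta = beta).
    by apply: le_trans small _; rewrite /C; lra.
  by have [h _] := step _ xb eb; apply: le_trans h _; rewrite /C; lra.
have etaC beta : eta <> beta -> `|gpb p eta beta - gpb y (F eta) (F beta)| <= C.
  move=> eb; have [<-|xb] := pselect (xi = beta).
    rewrite gpbC (gpbC y); apply: le_trans small _; rewrite /C; lra.
  by have [_ h] := step _ xb eb; apply: le_trans h _; rewrite /C; lra.
move=> alpha beta ab.
have [e1|xa] := pselect (xi = alpha); first by rewrite -e1 in ab *; exact: xiC.
have [e1|ea] := pselect (eta = alpha); first by rewrite -e1 in ab *; exact: etaC.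
have [e1|xb] := pselect (xi = beta).
  by rewrite gpbC (gpbC y) -e1; exact: xiC.
have [e1|eb] := pselect (eta = beta).
  by rewrite gpbC (gpbC y) -e1; exact: etaC.
have /ler_normlP[? ?] := crpy alpha xi beta eta ab (nesym ea) xb xe.
have [/ler_normlP[? ?] _] := step _ xb eb.
have [_] := step _ xa ea; rewrite (gpbC p eta) (gpbC y (F eta)) => /ler_normlP[? ?].
move: small => /ler_normlP[? ?].
by rewrite /C; apply/ler_normlP; split; lra.
Qed.

Section EquivariantExtension.
Context {R : realType} {G : groupType} {X Y : metricType R}.
Variables (a : isometric_action G X) (b : isometric_action G Y) (dX dY : R).
Hypotheses (hX : hyperbolic dX X) (dX0 : 0 <= dX).
Hypotheses (hY : hyperbolic dY Y) (dY0 : 0 <= dY).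
Variable F : boundary X -> boundary Y.
Hypothesis F_inj : injective F.
Hypothesis F_act : forall g xi, F (act_boundary a g xi) = act_boundary b g (F xi).

Lemma gpb_act (Z : metricType R) (c : isometric_action G Z) (d : R) g (p : Z) alpha beta :
  hyperbolic d Z -> 0 <= d -> alpha <> beta ->
  `|gpb (c g p) (act_boundary c g alpha) (act_boundary c g beta)
    - gpb p alpha beta| <= 6 * d.
Proof.
move=> hZ d0 ab; have [n [/= h1 /ler_normlP[? ?]]] := filter_ex (filterI
  (gp_act_near c hZ d0 (c g p) g ab) (gpb_near hZ d0 p ab)).
rewrite act_gp in h1; move: h1 => /ler_normlP[? ?].
by apply/ler_normlP; split; lra.
Qed.

Lemma compatible_act g C p y : compatible F C p y ->
  compatible F (C + 6 * (dX + dY)) (a g p) (b g y).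
Proof.
move=> py alpha beta; rewrite -(act_boundaryK_inv a hX g alpha).
rewrite -(act_boundaryK_inv a hX g beta).
set al := act_boundary a _ alpha; set be := act_boundary a _ beta.
clearbody al be => ne; rewrite !F_act.
have {}ne : al <> be by move=> e; apply: ne; rewrite e.
have Fne : F al <> F be by move/F_inj.
have /ler_normlP[? ?] := py _ _ ne.
have /ler_normlP[? ?] := gpb_act a g p hX dX0 ne.
have /ler_normlP[? ?] := gpb_act b g y hY dY0 Fne.
by apply/ler_normlP; split; lra.
Qed.

(** Let [psi] be any choice of compatible points. In an orbit containing a point [q]
    whose stabilizer fixes [psi q], the values are transported from [q]. In the other
    orbits [psi] is kept: at none of their points does the stabilizer condition of
    the second clause hold. *)
Lemma equivariant_extension C : (forall p, exists y, compatible F C p y) ->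
  exists phi : X -> Y, (forall p, compatible F (C + 6 * (dX + dY)) p (phi p)) /\
    forall p, (forall g, a g p = p -> b g (phi p) = phi p) ->
    forall g, phi (a g p) = b g (phi p).
Proof.
move=> /choice[psi hpsi].
pose good q := forall g, a g q = q -> b g (psi q) = psi q.
pose orbit p := [set q | good q /\ exists g, a g q = p].
pose center (A : set X) := if pselect (exists q, A q) is left e
  then Some (sval (cid e)) else None.
have centerP p q : center (orbit p) = Some q -> orbit p q.
  by rewrite /center; case: pselect => // e [<-]; case: cid.
pose carrier p q := [set g | a g q = p].
pose phi p := if center (orbit p) is Some q
  then b (xget 1%g (carrier p q)) (psi q) else psi p.
have orbit_act g p : orbit (a g p) = orbit p.
  apply/seteqP; split=> q [gq [k kq]]; split => //.
    by exists (g^-1 * k)%g; rewrite actM kq act_invK.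
  by exists (g * k)%g; rewrite actM kq.
have phiE p q g : center (orbit p) = Some q -> a g q = p -> phi p = b g (psi q).
  move=> cp gq; rewrite /phi cp; have [gq' _] := centerP _ _ cp.
  have : carrier p q (xget 1%g (carrier p q)) by apply: xgetPex; exists g.
  rewrite /carrier /=; set k := xget _ _ => kq.
  have : b (g^-1 * k)%g (psi q) = psi q.
    by apply: gq'; rewrite actM kq -gq act_invK.
  by rewrite actM => /(congr1 (b g)); rewrite actK_inv.
exists phi; split=> [p|p stab g].
  case E : (center (orbit p)) => [q|].
    have [_ [g gq]] := centerP _ _ E; rewrite (phiE _ _ _ E gq) -gq.
    exact: compatible_act.
  rewrite /phi E => alpha beta ne; apply: le_trans (hpsi p _ _ ne) _.
  by have := dX0; have := dY0; lra.
case E : (center (orbit p)) => [q|].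
  have [_ [k kq]] := centerP _ _ E.
  have E' : center (orbit (a g p)) = Some q by rewrite orbit_act.
  by rewrite (phiE _ _ _ E kq) (phiE _ _ (g * k)%g E') ?actM ?kq.
have gp' : good p by move=> k kp; have := stab k kp; rewrite /phi E.
have : exists q, orbit p q by exists p; split => //; exists 1%g; rewrite act1.
by move: E; rewrite /center; case: pselect.
Qed.

End EquivariantExtension.

Section Comparable.
Context {R : realType} {G : groupType} {X Y : metricType R}.
Variables (a : isometric_action G X) (b : isometric_action G Y) (dX dY : R).
Hypotheses (hX : hyperbolic dX X) (dX0 : 0 <= dX).
Hypotheses (hY : hyperbolic dY Y) (dY0 : 0 <= dY).

Lemma comparable_boundary_map : comparable_actions a b ->
  limit_set a setT = gromov_boundary X -> limit_set b setT = gromov_boundary Y ->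
  exists (F : boundary X -> boundary Y) (F' : boundary Y -> boundary X),
    [/\ cancel F F', cancel F' F, boundary_continuous F, boundary_continuous F' &
      forall g xi, F (act_boundary a g xi) = act_boundary b g (F xi)].
Proof.
move=> [f [f' [fK f'K fc f'c fact]]] lX lY.
have mX xi : boundary_pt xi \in limit_set a setT.
  by rewrite lX; apply/mem_set; exists xi.
have mY eta : boundary_pt eta \in limit_set b setT.
  by rewrite lY; apply/mem_set; exists eta.
pose iX xi : limit_set a setT := exist _ (boundary_pt xi) (mX xi).
pose iY eta : limit_set b setT := exist _ (boundary_pt eta) (mY eta).
have valY y : exists eta, val (y : limit_set b setT) = boundary_pt eta.
  by have := set_mem (valP y); rewrite {1}lY => -[eta _ e]; exists eta.
have valX x : exists xi, val (x : limit_set a setT) = boundary_pt xi.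
  by have := set_mem (valP x); rewrite {1}lX => -[xi _ e]; exists xi.
have [F hF] := choice (fun xi => valY (f (iX xi))).
have [F' hF'] := choice (fun eta => valX (f' (iY eta))).
have fF xi : f (iX xi) = iY (F xi) by apply: val_inj; rewrite hF.
have fF' eta : f' (iY eta) = iX (F' eta) by apply: val_inj; rewrite hF'.
exists F, F'; split.
- move=> xi; have := congr1 val (fK (iX xi)).
  by rewrite fF hF' => /boundary_pt_inj.
- move=> eta; have := congr1 val (f'K (iY eta)).
  by rewrite fF' hF => /boundary_pt_inj.
- exact: (continuous_boundary_map hX dX0 hY dY0 (mA := mX) hF fc).
- exact: (continuous_boundary_map hY dY0 hX dX0 (mA := mY) hF' f'c).
- move=> g xi; have := fact g (iX xi) (iX (act_boundary a g xi)) erefl.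
  by rewrite !hF => /boundary_pt_inj.
Qed.

End Comparable.

Lemma compatible_sym {R : realType} {X Y : metricType R} (F : boundary X -> boundary Y)
    (F' : boundary Y -> boundary X) (C : R) p y :
  cancel F' F -> compatible F C p y -> compatible F' C y p.
Proof.
move=> F'K py alpha beta ab; rewrite distrC -{2}(F'K alpha) -{2}(F'K beta).
by apply: py => e; apply: ab; rewrite -(F'K alpha) -(F'K beta) e.
Qed.

Lemma compatible_le {R : realType} {X Y : metricType R} (F : boundary X -> boundary Y)
    (C C' : R) p y : C <= C' -> compatible F C p y -> compatible F C' p y.
Proof. by move=> CC' py alpha beta ab; exact: le_trans (py _ _ ab) CC'. Qed.

(** Translation lengths are invariant under conjugation, and both
    [s (h (s' s)) s^-1] and [s'^-1 ((s' s) h) s'] are equal to [s h s']. *)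
Lemma double_coset_lengths {R : realType} {G : groupType} {X Y : metricType R}
    (a : isometric_action G X) (b : isometric_action G Y) (H : groupClosed G) (h : G) :
  (forall g, g \in H -> forall (p : X) (q : Y),
     translation_length a p (h * g)%g = translation_length b q (h * g)%g) \/
  (forall g, g \in H -> forall (p : X) (q : Y),
     translation_length a p (g * h)%g = translation_length b q (g * h)%g) ->
  forall s s', s \in H -> s' \in H -> forall (p : X) (q : Y),
    translation_length a p (s * h * s')%g = translation_length b q (s * h * s')%g.
Proof.
case=> len s s' Hs Hs' p q.
  have -> : (s * h * s' = s * (h * (s' * s)) * s^-1)%g by rewrite !mulgA mulgK.
  by rewrite !translation_length_conj; apply: len; rewrite gpredM.
have -> : (s * h * s' = s'^-1 * (s' * s * h) * s'^-1^-1)%g.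
  by rewrite invgK -!mulgA mulKg.
by rewrite !translation_length_conj; apply: len; rewrite gpredM.
Qed.

Lemma cross_ratio_transfer {R : realType} {G : groupType} {X Y : metricType R}
    (a : isometric_action G X) (b : isometric_action G Y) (dX dY : R)
    (F : boundary X -> boundary Y) (F' : boundary Y -> boundary X)
    (H : groupClosed G) (h : G) (o : X) (o' : Y) :
  hyperbolic dX X -> 0 <= dX -> hyperbolic dY Y -> 0 <= dY ->
  cancel F F' -> cancel F' F -> boundary_continuous F -> boundary_continuous F' ->
  (forall g xi, F (act_boundary a g xi) = act_boundary b g (F xi)) ->
  three_points (boundary X) -> (forall xi, orbit_limit a [set` H] xi) ->
  (forall s s', s \in H -> s' \in H ->
    translation_length a o (s * h * s')%g = translation_length b o' (s * h * s')%g) ->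
  exists C, forall alpha xi beta eta,
    alpha <> beta -> alpha <> eta -> xi <> beta -> xi <> eta ->
    `|cross_ratio o alpha xi beta eta -
      cross_ratio o' (F alpha) (F xi) (F beta) (F eta)| <= C.
Proof.
move=> hX d0 hY d0' FK F'K Fc F'c Fact three acc len.
have [dense|[i fi]] := dense_orbits_or_fixed hX d0 acc.
  have [k Hk ax] : exists2 k, k \in H & axial a dX o k.
    apply: (exists_axial hX d0) => //.
    by have [x [y [z [xy _ _]]]] := three; exists x, y.
  have [kp [km [kkp kkm _]]] := axial_limits hX d0 ax.
  exists (34 * (dX + dY)); exact: (cross_ratio_transfer_dense hX d0 hY d0'
    (can_inj FK) Fc Fact three dense Hk kkp kkm len).
exact: (cross_ratio_transfer_fixed hX d0 hY d0' FK F'K Fc F'c Fact three acc len fi).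
Qed.

Lemma visible_from {R : realType} {G : groupType} {X : metricType R}
    (a : isometric_action G X) (delta K : R) (H : groupClosed G) :
  hyperbolic delta X -> 0 <= delta -> 0 < K -> roughly_complete K X ->
  three_points (boundary X) -> (forall xi, orbit_limit a [set` H] xi) ->
  forall p : X, exists xi eta, xi <> eta /\
    \forall n \near \oo, gp p (rep xi n) (rep eta n) <= 3 / 2 * K + 3 * delta.
Proof.
move=> hX d0 K0 complete [x [y [z [xy _ _]]]] acc p.
have [k Hk ax] : exists2 k, k \in H & axial a delta p k.
  by apply: (exists_axial hX d0) => //; exists x, y.
have [kp [km [kkp kkm _]]] := axial_limits hX d0 ax.
exact: (coarse_bi_infinite hX d0 K0 complete kkp kkm).
Qed.

Theorem theorem6 (R : realType) (G : groupType) (X Y : metricType R)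
    (a : isometric_action G X) (b : isometric_action G Y)
    (H : groupClosed G) (h : G) :
  roughly_geodesically_complete X ->
  roughly_geodesically_complete Y ->
  comparable_actions a b ->
  geometrically_dense a ->
  geometrically_dense b ->
  limit_set a [set` H] = limit_set a setT ->
  limit_set b [set` H] = limit_set b setT ->
  (forall g, g \in H -> forall (p : X) (q : Y),
     translation_length a p (h * g)%g = translation_length b q (h * g)%g) \/
  (forall g, g \in H -> forall (p : X) (q : Y),
     translation_length a p (g * h)%g = translation_length b q (g * h)%g) ->
  (forall (g : G) (p : X) (q : Y),
     translation_length a p g = translation_length b q g) /\
  exists (phi : X -> Y) (C : R),
    [/\ 0 < C, roughly_equivariant a b C phi, rough_isometry C phi &
      forall p q : X, `|mdist (phi p) (phi q) - mdist p q| < C].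
Proof.
move=> [KX [dX [KX0 /ltW dX0 [geoX hX] _ compX]]].
move=> [KY [dY [KY0 /ltW dY0 [geoY hY] _ compY]]] comp [elX lX] [elY lY] lHX lHY.
move=> /double_coset_lengths len.
have threeX := three_boundary_points hX dX0 elX.
have threeY := three_boundary_points hY dY0 elY.
have [F [F' [FK F'K Fc F'c Fact]]] :=
  comparable_boundary_map hX dX0 hY dY0 comp lX lY.
have [Finj F'inj] := (can_inj FK, can_inj F'K).
have accX xi : orbit_limit a [set` H] xi.
  by move=> q r; apply: (limit_set_gp_above hX dX0); rewrite lHX lX; exists xi.
have accY eta : orbit_limit b [set` H] eta.
  by move=> q r; apply: (limit_set_gp_above hY dY0); rewrite lHY lY; exists eta.
pose o := rep (sval (cid threeX)) 0%N; pose o' := rep (sval (cid threeY)) 0%N.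
have [C0 hC0] := cross_ratio_transfer hX dX0 hY dY0 FK F'K Fc F'c Fact threeX accX
  (fun s s' Hs Hs' => len s s' Hs Hs' o o').
have visX := visible_from hX dX0 KX0 compX threeX accX.
have visY := visible_from hY dY0 KY0 compY threeY accY.
set VX := _ + 3 * dX in visX; set VY := _ + 3 * dY in visY.
have [CX hCX] := exists_compatible hX dX0 hY dY0 Finj threeX visX KY0 geoY hC0.
have hC0' alpha xi beta eta : alpha <> beta -> alpha <> eta -> xi <> beta ->
    xi <> eta -> `|cross_ratio o' alpha xi beta eta -
      cross_ratio o (F' alpha) (F' xi) (F' beta) (F' eta)| <= C0.
  move=> ab ae xb xe; rewrite distrC.
  rewrite -{2}(F'K alpha) -{2}(F'K xi) -{2}(F'K beta) -{2}(F'K eta).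
  by apply: hC0 => /F'inj.
have [CY hCY] := exists_compatible hY dY0 hX dX0 F'inj threeY visY KX0 geoX hC0'.
have [phi [cphi phi_eq]] := equivariant_extension hX dX0 hY dY0 Finj Fact hCX.
set C1 := CX + _ in cphi.
pose C2 := `|C1| + `|CY| + 6 * (dX + dY).
pose D := 2 * `|VX| + 2 * `|VY| + 6 * C2 + 14 * dX + 14 * dY.
have C1C2 : C1 <= C2 by have := ler_norm C1; have := normr_ge0 CY; rewrite /C2; lra.
have CYC2 : CY <= C2 by have := ler_norm CY; have := normr_ge0 C1; rewrite /C2; lra.
have C16C2 : C1 + 6 * (dX + dY) <= C2.
  by have := ler_norm C1; have := normr_ge0 CY; rewrite /C2; lra.
have vX := ler_norm VX; have vY := ler_norm VY.
have vX0 := normr_ge0 VX; have vY0 := normr_ge0 VY.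
have distX p q y y' : compatible F C2 p y -> compatible F C2 q y' ->
    mdist p q <= mdist y y' + D.
  by move=> py qy; have := compatible_dist hX dX0 hY dY0 Finj threeX visX py qy;
    rewrite /D; lra.
have distY p q y y' : compatible F C2 p y -> compatible F C2 q y' ->
    mdist y y' <= mdist p q + D.
  move=> /(compatible_sym F'K) py /(compatible_sym F'K) qy.
  by have := compatible_dist hY dY0 hX dX0 F'inj threeY visY py qy; rewrite /D; lra.
have phiC p : compatible F C2 p (phi p) by exact: compatible_le (cphi p).
have iso p q : `|mdist (phi p) (phi q) - mdist p q| <= D.
  have := distX _ _ _ _ (phiC p) (phiC q); have := distY _ _ _ _ (phiC p) (phiC q).
  by move=> *; apply/ler_normlP; split; lra.
have D0 : 0 <= D := le_trans (normr_ge0 _) (iso o o).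
have equi g p : mdist (phi (a g p)) (b g (phi p)) <= D.
  have := distY _ _ _ _ (phiC (a g p)) (compatible_le C16C2
    (compatible_act hX dX0 hY dY0 Finj Fact g (cphi p))).
  by rewrite mdistxx add0r.
split=> [g p q|].
  apply: (@translation_length_eq _ _ _ _ a b (2 * mdist q (phi p) + 2 * D)) => n.
  have h1 := iso (a (g ^+ n)%g p) p; have h2 := equi (g ^+ n)%g p.
  have h3 := metric_triangle (b (g ^+ n)%g q) (b (g ^+ n)%g (phi p)) q.
  have h4 := metric_triangle (b (g ^+ n)%g (phi p)) (b (g ^+ n)%g q) (phi p).
  have h5 := metric_triangle (b (g ^+ n)%g q) q (phi p).
  have h6 := metric_triangle (b (g ^+ n)%g (phi p)) (phi p) q.
  have h7 := metric_triangle (phi (a (g ^+ n)%g p)) (b (g ^+ n)%g (phi p)) (phi p).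
  have h8 := metric_triangle (b (g ^+ n)%g (phi p)) (phi (a (g ^+ n)%g p)) (phi p).
  rewrite act_isometry in h3; rewrite act_isometry (metric_sym (phi p) q) in h4.
  rewrite (metric_sym (phi p) q) in h6.
  rewrite (metric_sym (b (g ^+ n)%g (phi p)) (phi (a (g ^+ n)%g p))) in h8.
  by move: h1 => /ler_normlP[? ?]; apply/ler_normlP; split; lra.
exists phi, (D + 1); split; first by lra.
- by split=> [g p|]; [apply: le_trans (equi g p) _; lra|exact: phi_eq].
- split=> [p q|]; first by apply: le_trans (iso p q) _; lra.
  exists D => y; have [x xy] := hCY y; exists x.
  have := distY _ _ _ _ (compatible_le CYC2 (compatible_sym FK xy)) (phiC x).
  by rewrite mdistxx add0r.
- by move=> p q; apply: le_lt_trans (iso p q) _; lra.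
Qed.
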